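(* Let $w:I\to(0,\infty)$ be a decreasing weight on $I=(0,a)$, $0<a\le\infty$, let $W(t)=\int_0^t w\,dm$, $b=\int_I w\,dm\in(0,\infty]$, $J=(0,b)$, and let $E$ be a fully symmetric Banach function space on $J$ with support $J$. Assume that $w$ is regular, that is, $W(t)\le C\,t\,w(t)$ for some constant $C\ge1$ and all $t\in I$. Then $M_{E,w}$ is a vector space and the formula $$|||f|||:=\inf\left\{\sum_{i=1}^n\|f_i\|_{M_{E,w}}:\ n\in\mathbb N,\ f_1,\dots,f_n\in M_{E,w},\ \sum_{i=1}^n|f_i|\ge|f|\right\}$$ defines a lattice norm $|||\cdot|||$ on $M_{E,w}$ such that $$|||f|||\le\|f\|_{M_{E,w}}\le C\,|||f|||,\qquad f\in M_{E,w}.$$ Consequently the class $M_{E,w}$ is a normable vector lattice.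
   Context: $m$ is Lebesgue measure; functions are identified when equal a.e.; ''decreasing'' means non-increasing. $L^0(I)$ is the space of real Lebesgue measurable functions on $I$. For a measure $\mu$ and a $\mu$-measurable $f$ on $\Omega$, $d_f^\mu(s)=\mu\{|f|>s\}$ and $f^{*,\mu}(t)=\inf\{s>0:d_f^\mu(s)\le t\}$ for $0\le t<\mu(\Omega)$; $f^*$ is the rearrangement for $\mu=m$, and $f^{*,w}$ the rearrangement with respect to the measure $w\,dm$ on $I$, a function on $J$. For functions on $J$, $g\prec h$ means $\int_0^x g^*\,dm\le\int_0^x h^*\,dm$ for all $x\in J$. A Banach function space on $J$ is a solid linear subspace $E$ of $L^0(J)$ with full support, complete under a monotone norm ($|f|\le|g|$ a.e. implies $\|f\|_E\le\|g\|_E$). It is fully symmetric if equimeasurable functions have equal norms and $f\prec g$, $f\in L^0(J)$, $g\in E$ imply $f\in E$ and $\|f\|_E\le\|g\|_E$. ''Support $J$'' means $\chi_A\in E$ whenever $m(A)<\infty$. $E_w=\{f\in L^0(I):f^{*,w}\in E\}$, $\|f\|_{E_w}=\|f^{*,w}\|_E$; $M_{E,w}=\{f\in L^0(I): f^*/w\in E_w\}$ with gauge $\|f\|_{M_{E,w}}=\|f^*/w\|_{E_w}$. A lattice norm is a norm with $|f|\le|g|$ a.e. implying $|||f|||\le|||g|||$. *)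

(* Defs.v *)
From HB Require Import structures.
From mathcomp Require Import all_boot all_order all_algebra.
From mathcomp Require Import all_classical all_reals all_analysis.

Set Implicit Arguments.
Unset Strict Implicit.
Unset Printing Implicit Defensive.

Import Order.TTheory GRing.Theory Num.Theory.
Import numFieldNormedType.Exports.

Local Open Scope classical_set_scope.
Local Open Scope ring_scope.

(* The real line with the sigma-algebra of Lebesgue (not only Borel)
   measurable sets; this is the domain of completed_lebesgue_measure.  It is a
   synonym of R, so functions below are plain functions R -> R, of which only
   the values on the relevant domain matter (up to null sets). *)
Definition lebesgueT (R : realType) :=
  caratheodory_type ((@wlength R idfun)^*)%mu.

Notation leb := completed_lebesgue_measure.

Section FunctionSpaces.
Context {R : realType}.
Implicit Types (a b : \bar R) (D : set R) (f g w : R -> R).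

Definition itv0 a : set R := [set x | 0 < x /\ (x%:E < a)%E].

Definition L0 D : set (R -> R) :=
  [set f | measurable_fun (D : set (lebesgueT R)) (f : lebesgueT R -> R)].

Definition ae_on D (P : R -> Prop) : Prop :=
  {ae @leb R, forall x, D x -> P x}.

(* The measure w dm, as a set function. *)
Definition wdm w (A : set R) : \bar R := (\int[@leb R]_(x in A) (w x)%:E)%E.

Definition distribution (mu : set R -> \bar R) D f (s : R) : \bar R :=
  mu (D `&` [set x | s < `|f x|]).

(* The infimum of the empty set is +oo: the rearrangement may be infinite. *)
Definition rearrangement (mu : set R -> \bar R) D f (t : R) : \bar R :=
  ereal_inf [set s%:E | s in
    [set s : R | 0 < s /\ (distribution mu D f s <= t%:E)%E]].

Definition submajorized D f g : Prop :=
  forall x, D x ->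
    (\int[@leb R]_(t in `]0%R, x[) rearrangement (@leb R) D f t <=
     \int[@leb R]_(t in `]0%R, x[) rearrangement (@leb R) D g t)%E.

Definition equimeasurable D f g : Prop :=
  forall s, 0 <= s -> distribution (@leb R) D f s = distribution (@leb R) D g s.

(* Linear subspaces of L^0(D).  Functions are identified when they agree a.e.,
   hence subspace_ae. *)
Record linear_subspace D (V : set (R -> R)) : Prop := LinearSubspace {
  subspace_L0 : V `<=` L0 D;
  subspace_ae : forall f g, V f -> L0 D g -> ae_on D (fun x => f x = g x) -> V g;
  subspace0 : V (fun=> 0);
  subspaceD : forall f g, V f -> V g -> V (fun x => f x + g x);
  subspaceZ : forall (c : R) f, V f -> V (fun x => c * f x) }.

Record vector_lattice D (V : set (R -> R)) : Prop := VectorLattice {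
  vlattice_subspace : linear_subspace D V;
  vlattice_max : forall f g, V f -> V g -> V (fun x => Num.max (f x) (g x));
  vlattice_min : forall f g, V f -> V g -> V (fun x => Num.min (f x) (g x)) }.

Record lattice_norm D (V : set (R -> R)) (N : (R -> R) -> R) : Prop :=
  LatticeNorm {
  norm_ge0 : forall f, V f -> 0 <= N f;
  norm_eq0 : forall f, V f -> (N f = 0 <-> ae_on D (fun x => f x = 0));
  normZ : forall (c : R) f, V f -> N (fun x => c * f x) = `|c| * N f;
  norm_triangle : forall f g, V f -> V g -> N (fun x => f x + g x) <= N f + N g;
  norm_mono : forall f g, V f -> V g ->
    ae_on D (fun x => `|f x| <= `|g x|) -> N f <= N g }.

Definition normed_complete (V : set (R -> R)) (N : (R -> R) -> R) : Prop :=
  forall u : nat -> R -> R, (forall n, V (u n)) ->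
    (forall e, 0 < e -> exists n0, forall i j, (n0 <= i)%N -> (n0 <= j)%N ->
       N (fun x => u i x - u j x) < e) ->
    exists2 f, V f & N (fun x => u n x - f x) @[n --> \oo] --> (0 : R).

(* bfs_support is the meaning of "E has support D". *)
Record banach_function_space D (E : set (R -> R)) (N : (R -> R) -> R) : Prop :=
  BanachFunctionSpace {
  bfs_subspace : linear_subspace D E;
  bfs_solid : forall f g, L0 D f -> E g ->
    ae_on D (fun x => `|f x| <= `|g x|) -> E f;
  bfs_norm : lattice_norm D E N;
  bfs_complete : normed_complete E N;
  bfs_support : forall A : set R, A `<=` D ->
    measurable (A : set (lebesgueT R)) -> (@leb R A < +oo)%E -> E (\1_A) }.

Record fully_symmetric D (E : set (R -> R)) (N : (R -> R) -> R) : Prop :=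
  FullySymmetric {
  fsym_bfs : banach_function_space D E N;
  fsym_equimeasurable : forall f g, E f -> E g -> equimeasurable D f g ->
    N f = N g;
  fsym_submajorized : forall f g, L0 D f -> E g -> submajorized D f g ->
    E f /\ N f <= N g }.

(* An extended real-valued function belongs to a class of real functions on D
   (modulo a.e. equality) when it is a.e. finite and its finite part does. *)
Definition belongs D (V : set (R -> R)) (g : R -> \bar R) : Prop :=
  ae_on D (fun x => g x \is a fin_num) /\ V (fun x => fine (g x)).

Section Weighted.
Variables (a : \bar R) (w : R -> R) (E : set (R -> R)) (N : (R -> R) -> R).

Let I := itv0 a.
Let J := itv0 (wdm w I).

Definition Ew : set (R -> R) :=
  [set f | L0 I f /\ belongs J E (rearrangement (wdm w) I f)].

Definition Ew_gauge f : R := N (fun t => fine (rearrangement (wdm w) I f t)).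

Definition star_over_w f (t : R) : \bar R :=
  (rearrangement (@leb R) I f t * ((w t)^-1)%:E)%E.

Definition MEw : set (R -> R) :=
  [set f | L0 I f /\ belongs I Ew (star_over_w f)].

Definition MEw_gauge f : R := Ew_gauge (fun t => fine (star_over_w f t)).

(* On MEw this set is bounded below by 0 and contains MEw_gauge f (n = 1). *)
Definition MEw_norm f : R :=
  inf [set r | exists n (F : 'I_n -> R -> R),
    [/\ (0 < n)%N, forall i, MEw (F i),
        ae_on I (fun x => `|f x| <= \sum_(i < n) `|F i x|) &
        r = \sum_(i < n) MEw_gauge (F i)]].

End Weighted.

(* The gauge q on the class V is equivalent to a lattice norm. *)
Definition normable D (V : set (R -> R)) (q : (R -> R) -> R) : Prop :=
  exists2 N : (R -> R) -> R, lattice_norm D V N &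
    exists c1 c2 : R, [/\ 0 < c1, 0 < c2 &
      forall f, V f -> c1 * N f <= q f /\ q f <= c2 * N f].

End FunctionSpaces.

(* Main.v *)
(* For nonnegative f, g and s >= 0, int_0^x g^{*,w} <= s x + int (|g| - s)^+ w dm,
   with equality at s = g^{*,w}(x); both facts come from the layer cake
   formula and make g |-> int_0^x g^{*,w} subadditive for each x.

   Let |f| <= sum |f_i|, h_i = f_i^*/w, k = f^*/w, and for x in J put
   s = sum h_i^{*,w}(x) and B = sum_i int (h_i - h_i^{*,w}(x))^+ w.  Subadditivity
   for w = 1 gives int_0^t f^* <= s W(t) + B for all t in I.  If
   f^*(t) > C s w(t), then min(f^*, C s w) is decreasing with value C s w(t) at t,
   so its integral over (0,t) is at least C s t w(t) >= s W(t); subtracting,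
   int_0^t (f^* - C s w)^+ <= B.  Hence int_I (k - C s)^+ w <= B, and therefore
   int_0^x k^{*,w} <= C s x + B <= C sum_i int_0^x h_i^{*,w}.  Full symmetry of E
   turns this into f in M_{E,w} and ||f|| <= C sum ||f_i||, from which everything
   else follows. *)
Require Import Defs.
From mathcomp Require Import all_boot all_order all_algebra.
From mathcomp Require Import all_classical all_reals all_analysis.
From mathcomp Require Import measurable_realfun lra.

Set Implicit Arguments.
Unset Strict Implicit.
Unset Printing Implicit Defensive.

Import Order.TTheory GRing.Theory Num.Theory.
Import numFieldNormedType.Exports.

Local Open Scope classical_set_scope.
Local Open Scope ring_scope.

(** The quotient f^*/w need not be monotone, so its w-rearrangement cannot be read off from f^*;
    hence the comparison of excesses over a level instead of rearrangements. The level is fixed by x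
    in J while t runs through all of I, so the error B does not depend on t. Two obstacles shape the
    rest. Real levels and cancellation require finiteness, whereas [rearrangement] may be infinite
    and membership in [MEw] gives finiteness only a.e.; monotonicity upgrades this to every point,
    and full symmetry forces decreasing right-continuous members of E to be integrable near 0, which
    makes B finite. Moreover, the order to which full symmetry applies involves rearrangements on J
    of functions that are already rearrangements; right-continuity identifies the two. The resulting
    inequality holds for every finite family, and membership of f is part of its conclusion. Empty
    families, pairs and repeated copies of one function then give the zero function, sums and scalar
    multiples. *)

Section LebesgueT.
Context {R : realType}.
Implicit Types (D : set R) (a : \bar R).

(** * Lebesgue measurability on intervals and the layer cake formula *)

#[global] Instance ae_leb_filter : Filter (almost_everywhere (@leb R)).
Proof. exact: (ae_filter_ringOfSetsType (@leb R)). Qed.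

Lemma ae_onW D (P : R -> Prop) : (forall x, D x -> P x) -> ae_on D P.
Proof. by move=> DP; exact: (@nearW _ (almost_everywhere (@leb R))). Qed.

Lemma measurable_lebesgueT D :
  is_interval D -> measurable (D : set (lebesgueT R)).
Proof. by move=> iD; apply: sub_caratheodory; exact: is_interval_measurable. Qed.

Lemma is_interval_itv0 a : is_interval (itv0 a).
Proof.
move=> x y [x0 _] [_ ya] z /andP[xz zy]; split; first exact: lt_le_trans xz.
by apply: le_lt_trans ya; rewrite lee_fin.
Qed.

Lemma itv0_neq0 a : (0 < a)%E -> exists t, itv0 a t.
Proof.
rewrite /itv0; case: a => [c| |//]; rewrite ?lte_fin => c0.
  by exists (c / 2) => /=; rewrite lte_fin; split; lra.
by exists 1; split => //; rewrite ltry.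
Qed.

Lemma measurable_itv0 a : measurable (itv0 a : set (lebesgueT R)).
Proof. exact/measurable_lebesgueT/is_interval_itv0. Qed.

Lemma measurable_itv_lebesgueT (i : interval R) :
  measurable ([set` i] : set (lebesgueT R)).
Proof. exact/measurable_lebesgueT/interval_is_interval. Qed.

Lemma itv0_fin (x : R) : itv0 x%:E = [set` `]0, x[].
Proof. by apply/seteqP; split=> y /=; rewrite /itv0/= in_itv/= lte_fin => /andP. Qed.

Lemma leb_itv0 (x : R) : 0 <= x -> @leb R (itv0 x%:E) = x%:E.
Proof.
move=> x0; rewrite itv0_fin [LHS](lebesgue_measure_itv `]0, x[)/= lte_fin.
by case: ltgtP x0 => // [_ _|<-//]; rewrite sube0.
Qed.

Lemma leb_set1 (x : R) : @leb R [set x] = 0%E.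
Proof. exact: (lebesgue_measure_set1 x). Qed.

Lemma leb_negligible D : measurable (D : set (lebesgueT R)) ->
  (@leb R).-negligible D -> @leb R D = 0%E.
Proof. by move=> mD /(negligibleP (@leb R) mD). Qed.

(** Superlevel sets of a monotone function on an interval are intervals. This is the source of
    measurability for [w], for rearrangements and for distributions. *)
Lemma nonincreasing_measurable D (f : R -> \bar R) : is_interval D ->
  (forall s t, D s -> D t -> s <= t -> (f t <= f s)%E) ->
  measurable_fun (D : set (lebesgueT R)) (f : lebesgueT R -> \bar R).
Proof.
move=> iD fD mD.
apply: (measurability _ (ErealGenOInfty.measurableE R)) => // _ [_ [r ->] <-].
rewrite set_itvoy.
apply: measurable_lebesgueT => x y [Dx _] [Dy /= rfy] z /andP[xz zy].
have Dz : D z by apply: (iD x y) => //; apply/andP.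
by split => //=; rewrite (lt_le_trans rfy)// fD.
Qed.

Lemma nonincreasing_measurableR D (f : R -> R) : is_interval D ->
  (forall s t, D s -> D t -> s <= t -> f t <= f s) ->
  measurable_fun (D : set (lebesgueT R)) (f : lebesgueT R -> R).
Proof.
move=> iD fD; apply/measurable_EFinP; exact: nonincreasing_measurable.
Qed.

Lemma measurable_id_lebesgueT D : measurable (D : set (lebesgueT R)) ->
  measurable_fun (D : set (lebesgueT R)) (idfun : lebesgueT R -> R).
Proof. by move=> mD _ Y mY; apply: measurableI => //; exact: sub_caratheodory. Qed.

Local Open Scope ereal_scope.

Lemma leb_itv_lt (s : R) (y : \bar R) : 0 <= y ->
  @leb R [set r | (s < r)%R /\ r%:E < y] = maxe (y - s%:E) 0.
Proof.
case: y => [y y0|_|//].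
  rewrite [X in leb X](_ : _ = [set` `]s, y[%R]); last first.
    by apply/seteqP; split => r /=; rewrite in_itv/= lte_fin => /andP.
  rewrite [LHS](lebesgue_measure_itv `]s, y[)/= lte_fin.
  case: ltP => [sy|ys]; first by rewrite max_l// -EFinB lee_fin subr_ge0 ltW.
  by rewrite max_r// -EFinB lee_fin subr_le0.
rewrite [X in leb X](_ : _ = [set` `]s, +oo[%R]); last first.
  by apply/seteqP; split => r /=; rewrite in_itv/= ltry andbT => -[].
by rewrite [LHS](lebesgue_measure_itv `]s, +oo[)/= ltry max_l// leey.
Qed.

(** Tonelli for [w x] on the region [s < r < f x]: integrating in [r] first gives the left side, in
    [x] first the right side. Extended values of [f] are allowed because it is also applied to a
    rearrangement. *)
Lemma layer_cake D (w : R -> R) (f : R -> \bar R) (s : R) :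
  measurable (D : set (lebesgueT R)) ->
  measurable_fun (D : set (lebesgueT R)) (w : lebesgueT R -> R) ->
  (forall x, D x -> 0 <= w x)%R ->
  measurable_fun (D : set (lebesgueT R)) (f : lebesgueT R -> \bar R) ->
  (forall x, D x -> 0 <= f x) ->
  \int[@leb R]_(x in D) (maxe (f x - s%:E) 0 * (w x)%:E) =
  \int[@leb R]_(r in `]s, +oo[) wdm w (D `&` [set x | r%:E < f x]).
Proof.
move=> mD mw w0 mf f0.
(* The zero extensions [f \_ D] and [w \_ D] place everything on the full product, where Tonelli is
   applied. *)
pose A : set (lebesgueT R * lebesgueT R) :=
  [set z | D z.1 /\ (s < z.2)%R /\ z.2%:E < (f \_ D) z.1].
pose g (z : lebesgueT R * lebesgueT R) := ((w \_ D) z.1)%:E * (\1_A z)%:E.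
have mfD : measurable_fun setT (f \_ D : lebesgueT R -> \bar R).
  exact/(measurable_restrictT _ mD).1.
have mwD : measurable_fun setT (w \_ D : lebesgueT R -> R).
  exact/(measurable_restrictT _ mD).1.
have mA : measurable A.
  rewrite [A](_ : _ = (D `*` [set` `]s, +oo[%R]) `&`
      [set z : lebesgueT R * lebesgueT R | z.2%:E < (f \_ D) z.1]); last first.
    apply/seteqP; split => [[x r]|[x r]] /=; rewrite /A/= in_itv/= andbT.
      by move=> [? []].
    by move=> [[]].
  apply: measurableI.
    by apply: measurableX => //; exact: measurable_itv_lebesgueT.
  rewrite -[X in measurable X]setTI.
  have : measurable_fun setT
      (fun z : lebesgueT R * lebesgueT R => z.2%:E < (f \_ D) z.1).
    apply: measurable_fun_lte.
      apply/measurable_EFinP.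
      exact: (measurableT_comp (measurable_id_lebesgueT measurableT)
        measurable_snd).
    exact: measurableT_comp mfD measurable_fst.
  by move=> /(_ measurableT [set true]); exact.
have mg : measurable_fun setT g.
  apply: emeasurable_funM; apply/measurable_EFinP.
    exact: measurableT_comp mwD measurable_fst.
  exact: measurable_indic.
have wD0 x : (0 <= (w \_ D) x)%R by rewrite patchE; case: ifPn => // /[!inE]/w0.
have g0 z : 0 <= g z by rewrite mule_ge0// lee_fin.
transitivity (\int[@leb R]_x \int[@leb R]_r g (x, r)).
  rewrite integral_mkcond; apply: eq_integral => x _.
  have mAx : measurable ([set r | A (x, r)] : set (lebesgueT R)).
    by move: (measurable_xsection x mA); rewrite xsectionE.
  rewrite [RHS](_ : _ = \int[@leb R]_r
      (((w \_ D) x)%:E * (\1_[set r | A (x, r)] r)%:E)); last first.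
    by apply: eq_integral => r _; rewrite /g/= !indicE; congr (_ * (nat_of_bool _)%:R%:E).
  have mIx : measurable_fun setT
      (EFin \o (\1_[set r | A (x, r)] : lebesgueT R -> R)).
    by apply/measurable_EFinP; exact: measurable_indic.
  have Ix0 r : [set: lebesgueT R] r -> 0 <= (\1_[set r | A (x, r)] r)%:E :> \bar R.
    by rewrite lee_fin.
  have wDx0 : 0 <= ((w \_ D) x)%:E by rewrite lee_fin.
  rewrite (ge0_integralZl (@leb R) measurableT mIx Ix0 wDx0).
  rewrite integral_indic//.
  rewrite setIT !patchE; case: ifPn => [xD|xD]; last by rewrite mul0e.
  rewrite muleC; congr (_ * _); rewrite -leb_itv_lt; last by rewrite f0// -in_setE.
  congr (leb _); apply/seteqP; split => r; rewrite /A/= patchE xD.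
    by split => //; exact: set_mem.
  by case.
transitivity (\int[@leb R]_r \int[@leb R]_x g (x, r)).
  exact: fubini_tonelli.
rewrite [RHS]integral_mkcond.
apply: eq_integral => r _.
have rE : (r \in [set` `]s, +oo[%R]) = (s < r)%R.
  by apply/idP/idP; rewrite inE/= in_itv/= andbT.
rewrite patchE rE; have [sr|rs] := ltP s r; last first.
  apply: integral0_eq => x _.
  by rewrite /g indicE memNset ?mule0// => -[_ [/= sr _]]; rewrite ltNge rs in sr.
rewrite /wdm [RHS]integral_mkcond; apply: eq_integral => x _.
rewrite /g indicE !patchE /A.
case: ifPn => xD; last first.
  rewrite mul0e ifF//; apply/negbTE; apply: contra xD.
  by rewrite !inE => -[].
case: ifPn => xrD.
  rewrite mem_set ?mule1//=; move: xrD xD; rewrite !inE/= => -[? ?] ?.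
  by split => //; split => //; rewrite patchE ifT ?inE.
rewrite memNset ?mule0//=; apply: contraNnot xrD => -[Dx [_]].
by rewrite patchE ifT ?inE.
Qed.

End LebesgueT.

(** * The rearrangement as a generalised inverse of the distribution function *)

Section Rearrangement.
Context {R : realType} (mu : set R -> \bar R) (D : set R) (f : R -> R).
Local Open Scope ereal_scope.

Lemma rearrangement_ge0 t : 0 <= rearrangement mu D f t.
Proof. by apply: le_ereal_inf_tmp => _ [s [/ltW s0 _] <-]; rewrite lee_fin. Qed.

Lemma le_rearrangement s t : (s <= t)%R ->
  rearrangement mu D f t <= rearrangement mu D f s.
Proof.
move=> st; apply: ereal_inf_le_tmp => _ [r [r0 rs] <-]; exists r => //.
by split => //; apply: le_trans rs _; rewrite lee_fin.
Qed.

Lemma measurable_rearrangement (A : set R) : is_interval A ->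
  measurable_fun (A : set (lebesgueT R))
    (rearrangement mu D f : lebesgueT R -> \bar R).
Proof.
by move=> iA; apply: (nonincreasing_measurable iA) => s t _ _; exact: le_rearrangement.
Qed.

End Rearrangement.

Section WeightedMeasure.
Context {R : realType} (D : set R) (w : R -> R).
Context (mD : measurable (D : set (lebesgueT R))).
Context (mw : measurable_fun (D : set (lebesgueT R)) (w : lebesgueT R -> R)).
Context (w0 : forall x, D x -> 0 <= w x).
Implicit Types (A B : set R) (f : R -> R) (r s t x : R).

Let d f r := Defs.distribution (wdm w) D f r.
Let rearr f t := rearrangement (wdm w) D f t.

Local Open Scope ereal_scope.

Lemma le_wdm A B : measurable (A : set (lebesgueT R)) ->
  measurable (B : set (lebesgueT R)) -> A `<=` B -> B `<=` D ->
  wdm w A <= wdm w B.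
Proof.
move=> mA mB AB BD.
have mwB : measurable_fun (B : set (lebesgueT R)) (EFin \o (w : lebesgueT R -> R)).
  by apply/measurable_EFinP; exact: measurable_funS mw.
apply: (ge0_subset_integral (@leb R) mA mB mwB _ AB).
by move=> x /BD/w0; rewrite lee_fin.
Qed.

Lemma wdm_ge0 A : A `<=` D -> 0 <= wdm w A.
Proof. by move=> AD; apply: integral_ge0 => x /AD/w0; rewrite lee_fin. Qed.

Lemma measurable_superlevel f r : L0 D f ->
  measurable (D `&` [set x | (r < `|f x|)%R] : set (lebesgueT R)).
Proof.
move=> mf.
have mnf : measurable_fun (D : set (lebesgueT R))
    (fun x : lebesgueT R => `|f x|%:E).
  by apply/measurable_EFinP; exact: measurableT_comp mf.
exact: (emeasurable_fun_o_infty mD mnf r%:E).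
Qed.

Lemma le_distribution f r s : L0 D f -> (r <= s)%R -> d f s <= d f r.
Proof.
move=> mf rs; apply: le_wdm; [exact: measurable_superlevel..| |exact: subIsetl].
by move=> x /= [Dx /(le_lt_trans rs)].
Qed.

Lemma distribution_ge0 f r : 0 <= d f r.
Proof. by apply: wdm_ge0; exact: subIsetl. Qed.

(** The superlevel sets at [r + 1/(n+1)] increase to the one at [r]; convergence along increasing
    sets also covers an infinite [d f r]. *)
Lemma distribution_right_continuous f r (t : \bar R) : L0 D f -> t < d f r ->
  exists2 r', (r < r')%R & t < d f r'.
Proof.
move=> mf tr; apply: contrapT => H.
pose F n := D `&` [set x | (r + n.+1%:R^-1 < `|f x|)%R].
have FU : \bigcup_n F n = D `&` [set x | (r < `|f x|)%R].
  apply/seteqP; split => [x [n _ [Dx /= h]]|x [Dx /= rx]].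
    by split => //=; rewrite (lt_trans _ h)// ltrDl invr_gt0.
  have fr0 : (0 < `|f x| - r)%R by rewrite subr_gt0.
  have [n _ /(_ _ (leqnn n)) h] := near_infty_natSinv_lt (PosNum fr0).
  by exists n => //; split => //=; rewrite addrC -ltrBrDr.
have : \int[@leb R]_(x in F n) (w x)%:E @[n --> \oo] --> d f r.
  rewrite /d /Defs.distribution /wdm -FU.
  apply: (@ge0_nondecreasing_set_cvg_integral _ (lebesgueT R) R F).
  - move=> m n mn; apply/subsetPset => x [Dx /= h]; split => //=.
    by rewrite (le_lt_trans _ h)// lerD2l lef_pV2 ?posrE// ler_nat.
  - by move=> n; exact: measurable_superlevel.
  - by move=> n; apply/measurable_EFinP; apply: measurable_funS mw => // x [].
  - by move=> n x [/w0]; rewrite lee_fin.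
move=> dcvg; suff : d f r <= t by rewrite leNgt tr.
rewrite -(cvg_lim _ dcvg)//; apply: lime_le; first by apply/cvg_ex; exists (d f r).
apply: nearW => n; rewrite leNgt; apply/negP => tn.
by apply: H; exists (r + n.+1%:R^-1)%R => //; rewrite ltrDl invr_gt0.
Qed.

(** If [d f r <= t], every level above [r] is admissible in the infimum; if [t < d f r],
    right-continuity leaves a gap above [r] without admissible levels. Integrals of rearrangements
    and their right-continuity are derived from this equivalence. *)
Lemma lt_rearrangement f r t : L0 D f -> (0 <= r)%R ->
  (r%:E < rearr f t) = (t%:E < d f r).
Proof.
move=> mf r0; apply/idP/idP => [rt|/(distribution_right_continuous mf)].
  rewrite ltNge; apply: contraTN rt => dt; rewrite -leNgt.
  (* The level is [r + e] because [r] may be 0, which the infimum excludes. *)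
  apply/lee_addgt0Pr => e e0; apply: ereal_inf_lbound.
  exists (r + e)%R => //; split; first by rewrite ltr_wpDl.
  by apply: le_trans dt; apply: le_distribution => //; rewrite lerDl ltW.
move=> [r' rr' tr']; apply: (@lt_le_trans _ _ r'%:E); first by rewrite lte_fin.
apply: le_ereal_inf_tmp => _ [s [s0 ds] <-]; rewrite lee_fin leNgt.
apply/negP => sr'; have := le_lt_trans ds tr'.
by rewrite ltNge le_distribution// ltW.
Qed.

End WeightedMeasure.

(** * The unweighted rearrangement as the case of weight 1 *)

Section UnitWeight.
Context {R : realType}.
Local Open Scope ereal_scope.

Lemma integral_cst_leb (A : set R) (k : \bar R) :
  measurable (A : set (lebesgueT R)) ->
  \int[@leb R]_(x in A) cst k x = k * @leb R A.
Proof. by move=> mA; exact: (integral_cst (@leb R) mA). Qed.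

Lemma wdm1 (A : set R) : measurable (A : set (lebesgueT R)) ->
  wdm (fun=> 1%R) A = @leb R A.
Proof. by move=> mA; rewrite /wdm [LHS](integral_cst (@leb R) mA) mul1e. Qed.

(** Lets f^* inherit the results on [wdm]: the two set functions agree on measurable sets, and
    superlevel sets are measurable. *)
Lemma rearrangement_wdm1 (D : set R) (f : R -> R) :
  measurable (D : set (lebesgueT R)) -> L0 D f ->
  rearrangement (@leb R) D f = rearrangement (wdm (fun=> 1%R)) D f.
Proof.
move=> mD mf; apply/funext => t; congr ereal_inf; apply/seteqP.
have dE s : Defs.distribution (wdm (fun=> 1%R)) D f s = Defs.distribution (@leb R) D f s.
  by rewrite /Defs.distribution wdm1//; exact: measurable_superlevel.
by split => _ [s] /= sP <-; exists s => //=; rewrite dE in sP *.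
Qed.

End UnitWeight.

(** * Integrals of rearrangements over initial intervals *)

Section RearrangementIntegral.
Context {R : realType} (D : set R) (w : R -> R).
Context (mD : measurable (D : set (lebesgueT R))).
Context (mw : measurable_fun (D : set (lebesgueT R)) (w : lebesgueT R -> R)).
Context (w0 : forall x, D x -> 0 <= w x).
Implicit Types (f : R -> R) (r s t x : R).

Let d f r := Defs.distribution (wdm w) D f r.
Let rearr f t := rearrangement (wdm w) D f t.

Local Open Scope ereal_scope.

Let measurable_distribution (A : set R) f : is_interval A -> L0 D f ->
  measurable_fun (A : set (lebesgueT R)) (d f : lebesgueT R -> \bar R).
Proof.
move=> iA mf; apply: nonincreasing_measurable => // s t _ _ st.
exact: le_distribution.
Qed.

Lemma integral_maxr0 f s : L0 D f -> (0 <= s)%R ->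
  \int[@leb R]_(x in D) (Num.max (`|f x| - s) 0 * w x)%:E =
  \int[@leb R]_(r in `]s, +oo[) d f r.
Proof.
move=> mf s0.
have -> : \int[@leb R]_(r in `]s, +oo[) d f r =
    \int[@leb R]_(r in `]s, +oo[) wdm w (D `&` [set x | r%:E < `|f x|%:E]) by [].
have mnf : measurable_fun (D : set (lebesgueT R))
    (fun x : lebesgueT R => `|f x|%:E).
  by apply/measurable_EFinP; exact: measurableT_comp mf.
rewrite -(layer_cake s mD mw w0 mnf); last by move=> x _; rewrite lee_fin.
by apply: eq_integral => x _; rewrite EFinM EFin_max.
Qed.

(** Layer cake on (0,x) with weight 1: by [lt_rearrangement], the part of (0,x) where f^{*,w} > r is
    the interval from 0 to min(x, d(r)). *)
Lemma integral_rearrangement f x : L0 D f -> (0 <= x)%R ->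
  \int[@leb R]_(t in `]0%R, x[) rearr f t =
  \int[@leb R]_(r in `]0%R, +oo[) mine x%:E (d f r).
Proof.
move=> mf x0; have mx := measurable_itv_lebesgueT `]0%R, x[.
have ix : is_interval [set` `]0%R, x[] by exact: interval_is_interval.
transitivity (\int[@leb R]_(r in `]0%R, +oo[)
    wdm (fun=> 1%R) ([set` `]0%R, x[] `&` [set t | r%:E < rearr f t])).
  rewrite -(layer_cake 0 mx _ _
    (measurable_rearrangement (wdm w) D f ix)); last 3 first.
  - exact: measurable_cst.
  - by move=> t _; exact: ler01.
  - by move=> t _; exact: rearrangement_ge0.
  apply: eq_integral => t _.
  by rewrite mule1 sube0 max_l//; exact: rearrangement_ge0.
apply: eq_integral => r; rewrite inE/= in_itv/= andbT => r0.
have -> : [set` `]0%R, x[] `&` [set t | r%:E < rearr f t] =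
    itv0 (mine x%:E (d f r)).
  apply/seteqP; split => t /=; rewrite /itv0/= in_itv/= lt_min lte_fin.
    by move=> [/andP[-> ->]]; rewrite (lt_rearrangement mD mw w0)// ltW.
  by move=> [-> /andP[-> ?]]; rewrite (lt_rearrangement mD mw w0)// ltW.
rewrite wdm1; last exact: measurable_itv0.
have := distribution_ge0 w0 f r; rewrite -/(d f r) => d0.
have : mine x%:E (d f r) \is a fin_num.
  rewrite ge0_fin_numE; last by rewrite le_min d0 lee_fin x0.
  by rewrite gt_min ltry.
by move=> /fineK <-; rewrite leb_itv0// fine_ge0// le_min d0 lee_fin x0.
Qed.

(** Split at r = s: the integrand min(x, d(r)) is bounded by x below the level and by d(r) above
    it. *)
Lemma integral_rearrangement_le f s x : L0 D f -> (0 <= s)%R -> (0 <= x)%R ->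
  \int[@leb R]_(t in `]0%R, x[) rearr f t <=
  (s * x)%:E + \int[@leb R]_(y in D) (Num.max (`|f y| - s) 0 * w y)%:E.
Proof.
move=> mf s0 x0; rewrite integral_rearrangement// integral_maxr0//.
have mI (i : interval R) := measurable_itv_lebesgueT i.
have mmin (i : interval R) : measurable_fun ([set` i] : set (lebesgueT R))
    ((fun r => mine x%:E (d f r)) : lebesgueT R -> \bar R).
  apply: measurable_mine; first exact: measurable_cst.
  exact/measurable_distribution/mf/interval_is_interval.
have min0 r : 0 <= mine x%:E (d f r).
  by rewrite le_min lee_fin x0; exact: distribution_ge0.
have E : [set` `]0%R, +oo[] = [set` `]0%R, s]] `|` [set` `]s, +oo[%R].
  apply/seteqP; split => r /=; rewrite !in_itv/= !andbT.
    by move=> ->; case: leP => _; [left|right].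
  by move=> [/andP[]//|]; exact: le_lt_trans.
have disj : [disjoint [set` `]0%R, s]] & [set` `]s, +oo[%R]].
  apply/disj_setPLR => r /=; rewrite !in_itv/= andbT => /andP[_ rs] /=.
  by apply/negP; rewrite -leNgt.
have mU := mmin `]0%R, +oo[%R; rewrite E in mU.
rewrite E (ge0_integral_setU (@leb R) (mI _) (mI _) mU (fun r _ => min0 r) disj).
apply: leeD.
  apply: (@le_trans _ _ (\int[@leb R]_(r in `]0%R, s]) cst x%:E r)).
    apply: (ge0_le_integral (@leb R) (mI _) (fun r _ => min0 r) (mmin _)).
      exact: measurable_cst.
    by move=> r _; rewrite ge_min lexx.
  rewrite (integral_cst_leb _ (mI _)) [leb _](lebesgue_measure_itv `]0%R, s])/=.
  rewrite lte_fin sube0; case: ltgtP s0 => // [s0|<-] _; first by rewrite mulrC.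
  by rewrite mul0r mule0.
apply: (ge0_le_integral (@leb R) (mI _) (fun r _ => min0 r) (mmin _)).
  exact/measurable_distribution/mf/interval_is_interval.
by move=> r _; rewrite ge_min lexx orbT.
Qed.

(** At s = f^{*,w}(x) the bounds by x and by d(r) are attained: d(r) > x for r < s, and d(r) <= x
    for r > s. The point r = s is dropped by inclusion of domains. *)
Lemma le_integral_rearrangement f s x : L0 D f -> (0 <= x)%R ->
  rearr f x = s%:E ->
  (s * x)%:E + \int[@leb R]_(y in D) (Num.max (`|f y| - s) 0 * w y)%:E <=
  \int[@leb R]_(t in `]0%R, x[) rearr f t.
Proof.
move=> mf x0 fxs.
have s0 : (0 <= s)%R by rewrite -lee_fin -fxs; exact: rearrangement_ge0.
rewrite integral_rearrangement// integral_maxr0//.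
have mI (i : interval R) := measurable_itv_lebesgueT i.
have mmin (A : set R) : is_interval A -> measurable_fun (A : set (lebesgueT R))
    ((fun r => mine x%:E (d f r)) : lebesgueT R -> \bar R).
  move=> iA; apply: measurable_mine; first exact: measurable_cst.
  exact: measurable_distribution.
have min0 r : 0 <= mine x%:E (d f r).
  by rewrite le_min lee_fin x0; exact: distribution_ge0.
have ioo : is_interval ([set` `]0%R, +oo[%R] : set R) by exact: interval_is_interval.
have disj : [disjoint [set` `]0%R, s[] & [set` `]s, +oo[%R]].
  apply/disj_setPLR => r /=; rewrite !in_itv/= andbT => /andP[_ rs] /=.
  by apply/negP; rewrite -leNgt ltW.
have sub : [set` `]0%R, s[] `|` [set` `]s, +oo[%R] `<=` [set` `]0%R, +oo[%R].
  by move=> r /=; rewrite !in_itv/= !andbT => -[/andP[]//|]; exact: le_lt_trans.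
have mU : measurable_fun ([set` `]0%R, s[] `|` [set` `]s, +oo[%R] : set (lebesgueT R))
    ((fun r => mine x%:E (d f r)) : lebesgueT R -> \bar R).
  exact: measurable_funS (mI _) sub (mmin _ ioo).
apply: le_trans (ge0_subset_integral (@leb R) (measurableU _ _ (mI _) (mI _))
  (mI _) (mmin _ ioo) (fun r _ => min0 r) sub).
rewrite (ge0_integral_setU (@leb R) (mI _) (mI _) mU (fun r _ => min0 r) disj).
apply: leeD.
  rewrite le_eqVlt; apply/orP; left; apply/eqP.
  transitivity (\int[@leb R]_(r in `]0%R, s[) cst x%:E r).
    rewrite (integral_cst_leb _ (mI _)).
    rewrite [leb _](lebesgue_measure_itv `]0%R, s[)/=.
    rewrite lte_fin sube0; case: ltgtP s0 => // [s0|<-] _; first by rewrite mulrC.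
    by rewrite mul0r mule0.
  apply: eq_integral => r; rewrite inE/= in_itv/= => /andP[r0 rs].
  rewrite min_l//; apply: ltW.
  by rewrite -(lt_rearrangement mD mw w0) ?ltW// -/(rearr f x) fxs lte_fin.
rewrite le_eqVlt; apply/orP; left; apply/eqP.
apply: eq_integral => r; rewrite inE/= in_itv/= andbT => sr.
rewrite min_r// leNgt -(lt_rearrangement mD mw w0) ?(le_trans s0) ?ltW//.
by rewrite -/(rearr f x) fxs lte_fin -leNgt ltW.
Qed.

End RearrangementIntegral.

(** * Subadditivity of the integrated rearrangement *)

Section Subadditivity.
Context {R : realType} (D : set R) (w : R -> R).
Context (mD : measurable (D : set (lebesgueT R))).
Context (mw : measurable_fun (D : set (lebesgueT R)) (w : lebesgueT R -> R)).
Context (w0 : forall x, D x -> 0 <= w x).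
Local Open Scope ereal_scope.

Lemma measurable_maxr0 (f : R -> R) (s : R) : L0 D f ->
  measurable_fun (D : set (lebesgueT R))
    ((fun x => (Num.max (`|f x| - s) 0 * w x)%:E) : lebesgueT R -> \bar R).
Proof.
move=> mf; apply/measurable_EFinP; apply: measurable_funM; last exact: mw.
apply: measurable_maxr; last exact: measurable_cst.
by apply: measurable_funB; [exact: measurableT_comp mf|exact: measurable_cst].
Qed.

Lemma maxr0_ge0 (f : R -> R) (s x : R) : D x ->
  0 <= (Num.max (`|f x| - s) 0 * w x)%:E.
Proof. by move=> /w0 wx0; rewrite lee_fin mulr_ge0// le_max lexx orbT. Qed.

(** Each [F i] is cut at the value of its own rearrangement at [x], where the lower bound holds, and
    [f] at the sum of these values, since the upper bound holds at any level. In between, the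
    positive part of a sum is at most the sum of the positive parts. *)
Lemma submajorized_sum n (f : R -> R) (F : 'I_n -> R -> R) (x : R) :
  L0 D f -> (forall i, L0 D (F i)) ->
  ae_on D (fun y => `|f y| <= \sum_(i < n) `|F i y|)%R -> (0 <= x)%R ->
  (forall i, rearrangement (wdm w) D (F i) x \is a fin_num) ->
  \int[@leb R]_(t in `]0%R, x[) rearrangement (wdm w) D f t <=
  \sum_(i < n) \int[@leb R]_(t in `]0%R, x[) rearrangement (wdm w) D (F i) t.
Proof.
move=> mf mF fF x0 Fx.
pose s i := fine (rearrangement (wdm w) D (F i) x).
have s0 i : (0 <= s i)%R by rewrite fine_ge0//; exact: rearrangement_ge0.
have ss0 : (0 <= \sum_(i < n) s i)%R by exact: sumr_ge0.
apply: (le_trans (integral_rearrangement_le mD mw w0 mf ss0 x0)).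
apply: (@le_trans _ _ (\sum_(i < n) ((s i * x)%:E +
    \int[@leb R]_(y in D) (Num.max (`|F i y| - s i) 0 * w y)%:E))); last first.
  apply: lee_sum => i _; apply: le_integral_rearrangement => //.
  by rewrite fineK.
rewrite big_split/= mulr_suml -sumEFin; apply: leeD => //.
have mFs i := measurable_maxr0 (s i) (mF i).
rewrite -(ge0_integral_sum (@leb R) mD mFs (fun i y => @maxr0_ge0 (F i) (s i) y)).
apply: (ae_ge0_le_integral mD).
- by move=> y; exact: maxr0_ge0.
- exact: measurable_maxr0.
- by move=> y Dy; apply: sume_ge0 => i _; exact: maxr0_ge0.
- by apply: emeasurable_sum => i; exact: mFs.
rewrite /ae_on in fF; apply: filterS fF => y + Dy => /(_ Dy) fFy.
rewrite sumEFin lee_fin -mulr_suml ler_wpM2r ?w0// ge_max; apply/andP; split.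
  rewrite lerBlDr -big_split/= (le_trans fFy)//; apply: ler_sum => i _.
  by rewrite -lerBlDr le_max lexx.
by apply: sumr_ge0 => i _; rewrite le_max lexx orbT.
Qed.

End Subadditivity.

(** * Comparison of a decreasing function with a multiple of a regular weight *)

Section LevelComparison.
Context {R : realType}.
Local Open Scope ereal_scope.

Lemma ae_neq (c : R) : {ae @leb R, forall x, x != c}.
Proof.
exists [set c]; split.
- by rewrite -set_itv1; exact: measurable_itv_lebesgueT.
- exact: leb_set1.
- by move=> x /= /negP; rewrite negbK => /eqP.
Qed.

Lemma integral_itv0_le (a B : \bar R) (f : R -> \bar R) :
  measurable_fun (itv0 a : set (lebesgueT R)) (f : lebesgueT R -> \bar R) ->
  (forall x, itv0 a x -> 0 <= f x) ->
  (forall q : R, q%:E < a -> \int[@leb R]_(x in itv0 q%:E) f x <= B) -> 0 <= B ->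
  \int[@leb R]_(x in itv0 a) f x <= B.
Proof.
move=> mf f0 fB B0.
(* The term [a - 1/(n+1)] keeps the endpoint below a finite [a]; the cap [n] makes it real when [a]
   is +oo. *)
pose F n : set R := itv0 (mine (a - n.+1%:R^-1%:E) n%:R%:E).
have Fa n : F n `<=` itv0 a.
  move=> x [x0]; rewrite lt_min => /andP[xa _]; split => //.
  by apply: (lt_le_trans xa); rewrite leeBlDr// leeDl// lee_fin invr_ge0.
have FU : \bigcup_n F n = itv0 a.
  apply/seteqP; split => [x [n _ /Fa//]|x [x0 xa]].
  have [e e0 xea] : exists2 e : R, (0 < e)%R & (x + e)%:E < a.
    case: a xa {mf f0 fB F Fa} => [a| |//]; rewrite ?lte_fin => xa.
      by exists ((a - x) / 2)%R; [rewrite divr_gt0// subr_gt0|rewrite lte_fin; lra].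
    by exists 1%R => //; rewrite ltry.
  have [n _ /= h] := near_infty_natSinv_lt (PosNum e0).
  pose m := maxn n (Num.truncn x).+1.
  exists m => //; split => //; rewrite lt_min; apply/andP; split.
    rewrite lteBrDr// -EFinD (le_lt_trans _ xea)// lee_fin lerD2l.
    by apply/ltW/h; exact: leq_maxl.
  rewrite lte_fin (lt_le_trans (truncnS_gt x))// ler_nat; exact: leq_maxr.
rewrite -FU.
have Fcvg : \int[@leb R]_(x in F n) f x @[n --> \oo] -->
    \int[@leb R]_(x in \bigcup_n F n) f x.
  apply: (@ge0_nondecreasing_set_cvg_integral _ (lebesgueT R) R F).
  - move=> m n mn; apply/subsetPset => x [x0]; rewrite lt_min => /andP[xa xm].
    split => //; rewrite lt_min; apply/andP; split.
      apply: (lt_le_trans xa); apply: leeB => //.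
      by rewrite lee_fin lef_pV2 ?posrE// ler_nat.
    by apply: (lt_le_trans xm); rewrite lee_fin ler_nat.
  - by move=> n; exact: measurable_itv0.
  - by move=> n; apply: measurable_funS mf; [exact: measurable_itv0|exact: Fa].
  - by move=> n x /Fa; exact: f0.
rewrite -(cvg_lim _ Fcvg)//; apply: lime_le.
  by apply/cvg_ex; eexists; exact: Fcvg.
apply: nearW => n; rewrite /F.
case: a fB {mf f0 F Fa FU Fcvg} => [a| |] fB.
- rewrite -EFinB -EFin_min; apply: fB; rewrite lte_fin gt_min; apply/orP; left.
  by rewrite ltrBlDr ltrDl invr_gt0.
- by rewrite addye// min_r ?leey//; apply: fB; rewrite ltry.
- rewrite addNye min_l ?leNye// (_ : itv0 -oo = set0) ?integral_set0//.
  by apply/seteqP; split => x // [].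
Qed.

(** Used with F = f^* and v = s w. Subtraction works only at [t] with [C * v t < F t], where min(F,
    C v) stays above [C * v t] on (0,t). Such [t] need not form an interval, so the bound reaches
    the whole domain through their supremum. *)
Lemma integral_maxr_itv0_le (a : \bar R) (F v : R -> R) (C B : R) :
  (forall s t, itv0 a s -> itv0 a t -> s <= t -> F t <= F s)%R ->
  (forall s t, itv0 a s -> itv0 a t -> s <= t -> v t <= v s)%R ->
  (forall t, itv0 a t -> 0 <= F t)%R -> (forall t, itv0 a t -> 0 <= v t)%R ->
  (0 <= C)%R -> (0 <= B)%R ->
  (forall t, itv0 a t -> wdm v (itv0 t%:E) <= (C * t * v t)%:E) ->
  (forall t, itv0 a t ->
    \int[@leb R]_(r in itv0 t%:E) (F r)%:E <= wdm v (itv0 t%:E) + B%:E) ->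
  \int[@leb R]_(r in itv0 a) (Num.max (F r - C * v r) 0)%:E <= B%:E.
Proof.
move=> dF dv F0 v0 C0 B0 rv FvB.
have iI : is_interval (itv0 a) by exact: is_interval_itv0.
have mF := nonincreasing_measurableR iI dF.
have mv := nonincreasing_measurableR iI dv.
pose P r := Num.max (F r - C * v r)%R 0%R.
have P0 r : (0 <= P r)%R by rewrite le_max lexx orbT.
have mP : measurable_fun (itv0 a : set (lebesgueT R)) (P : lebesgueT R -> R).
  apply: measurable_maxr; last exact: measurable_cst.
  apply: measurable_funB; first exact: mF.
  by apply: measurable_funM; [exact: measurable_cst|exact: mv].
have sub (t : R) : itv0 a t -> itv0 t%:E `<=` itv0 a.
  by move=> [_ ta] x [x0 xt]; split => //; exact: lt_trans ta.
have PB t : itv0 a t -> (C * v t < F t)%R ->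
    \int[@leb R]_(r in itv0 t%:E) (P r)%:E <= B%:E.
  move=> It Ft; have t0 := It.1.
  pose G r := Num.min (F r) (C * v r)%R.
  have mt := measurable_itv0 (t%:E : \bar R).
  have mS (f : R -> R) :
      measurable_fun (itv0 a : set (lebesgueT R)) (f : lebesgueT R -> R) ->
      measurable_fun (itv0 t%:E : set (lebesgueT R))
        (EFin \o (f : lebesgueT R -> R)).
    move=> mf; apply/measurable_EFinP.
    exact: (measurable_funS (measurable_itv0 a) (sub t It) mf).
  have mG : measurable_fun (itv0 a : set (lebesgueT R)) (G : lebesgueT R -> R).
    apply: measurable_minr; first exact: mF.
    by apply: measurable_funM; [exact: measurable_cst|exact: mv].
  have G0 r : itv0 t%:E r -> 0 <= (G r)%:E.
    move=> /(sub _ It) Ir; rewrite lee_fin le_min F0//=.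
    by apply: mulr_ge0 => //; exact: v0.
  have FE : \int[@leb R]_(r in itv0 t%:E) (F r)%:E =
      \int[@leb R]_(r in itv0 t%:E) (G r)%:E +
      \int[@leb R]_(r in itv0 t%:E) (P r)%:E.
    rewrite -(ge0_integralD (@leb R) mt G0 (mS _ mG) _ (mS _ mP)); last first.
      by move=> r _; rewrite lee_fin.
    apply: eq_integral => r _; rewrite -EFinD; congr EFin; rewrite /G /P.
    have [FC|/ltW FC] := leP (F r) (C * v r)%R.
      by rewrite max_r ?subr_le0// addr0.
    by rewrite max_l ?subr_ge0// addrC subrK.
  have CG : (C * t * v t)%:E <= \int[@leb R]_(r in itv0 t%:E) (G r)%:E.
    apply: (@le_trans _ _ (\int[@leb R]_(r in itv0 t%:E) cst (C * v t)%:E r)).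
      rewrite (integral_cst_leb _ mt) (leb_itv0 (ltW t0)) -EFinM lee_fin.
      by rewrite mulrAC.
    apply: (ge0_le_integral (@leb R) mt).
    - by move=> r _; rewrite lee_fin mulr_ge0// v0.
    - exact: measurable_cst.
    - exact: mS.
    move=> r tr; have Ir := sub _ It _ tr; have /ltW rt := tr.2.
    rewrite lee_fin in rt; rewrite lee_fin le_min; apply/andP; split.
      by apply: (le_trans (ltW Ft)); exact: dF.
    by rewrite ler_wpM2l// dv.
  have := FvB t It; rewrite FE => h.
  (* Both sides now contain [C * t * v t], a real number, so it can be cancelled in [\bar R]. *)
  have {}h := le_trans (leeD CG (lexx _)) (le_trans h (leeD (rv t It) (lexx _))).
  by rewrite leeD2lE// in h.
(* Below [tau], every (0,q) lies in some (0,t) with [C * v t < F t]; beyond [tau] the positive part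
   vanishes. If no such [t] exists, [tau] is -oo and (0,tau) is empty. *)
pose tau := ereal_sup [set t%:E | t in [set t | itv0 a t /\ (C * v t < F t)%R]].
have taua : tau <= a.
  by apply: ge_ereal_sup => _ [t [[_ /ltW ta] _] <-].
have suba : itv0 tau `<=` itv0 a.
  by move=> x [x0 xt]; split => //; exact: lt_le_trans taua.
have mP' (A : set R) : measurable (A : set (lebesgueT R)) -> A `<=` itv0 a ->
    measurable_fun (A : set (lebesgueT R)) (EFin \o (P : lebesgueT R -> R)).
  move=> mA Aa; apply/measurable_EFinP.
  exact: (measurable_funS (measurable_itv0 a) Aa mP).
have tauB : \int[@leb R]_(r in itv0 tau) (P r)%:E <= B%:E.
  apply: integral_itv0_le.
  - by apply: mP' => //; exact: measurable_itv0.
  - by move=> x _; rewrite lee_fin.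
  - move=> q /ereal_sup_gt[_ [t [It Ft] <-]].
    rewrite lte_fin => qt; apply: le_trans (PB t It Ft).
    apply: (ge0_subset_integral (@leb R)); [exact: measurable_itv0..| | |].
    + apply: mP'; [exact: measurable_itv0|exact: sub].
    + by move=> x _; rewrite lee_fin.
    + by move=> x [x0 xq]; split => //; apply: lt_trans xq _; rewrite lte_fin.
  - by rewrite lee_fin.
apply: le_trans tauB.
have mD : measurable (itv0 a `\` itv0 tau : set (lebesgueT R)).
  by apply: measurableD; exact: measurable_itv0.
have E : itv0 a = itv0 tau `|` (itv0 a `\` itv0 tau) by rewrite setDUK.
have mPU := mP' _ (measurable_itv0 a) (@subset_refl _ _); rewrite E in mPU.
have disj : [disjoint itv0 tau & itv0 a `\` itv0 tau].
  by apply/disj_setPRL => x [].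
rewrite E (ge0_integral_setU (@leb R) (measurable_itv0 tau) mD mPU _ disj);
  last by move=> x _; rewrite lee_fin.
rewrite -[leRHS]adde0; apply: leeD => //.
rewrite -(@integral0 _ _ _ (@leb R) (itv0 a `\` itv0 tau)).
apply: (ae_ge0_le_integral mD).
- by move=> x _; rewrite lee_fin.
- by apply: mP' => // x [].
- by [].
- exact: measurable_cst.
(* The supremum may be attained, so the integrand need not vanish at [tau] itself; this one point is
   discarded. For infinite [tau] the discarded point is 0, which is harmless. *)
apply: filterS (ae_neq (fine tau)) => x /eqP xtau [Ix Nx].
rewrite /= lee_fin ge_max lexx andbT subr_le0 leNgt; apply/negP => Fx.
have xt : x%:E <= tau by apply: ereal_sup_ubound; exists x.
apply: Nx; split; first exact: Ix.1.
rewrite lt_neqAle xt andbT; apply/eqP => xE; apply: xtau.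
by rewrite -xE.
Qed.

End LevelComparison.

(** * Fully symmetric spaces and right-continuous decreasing functions *)

Section FullySymmetric.
Context {R : realType} (b : \bar R).
Let J := itv0 b.
Implicit Types (H K : R -> R) (t x : R).

(* Rearrangements are right-continuous; on such functions the rearrangement acts
   as the identity everywhere, not only almost everywhere. *)
Record rc_nonincreasing H : Prop := RcNonincreasing {
  rc_ge0 : forall t, J t -> 0 <= H t;
  rc_anti : forall s t, J s -> J t -> s <= t -> H t <= H s;
  rc_right : forall t e, J t -> 0 < e ->
    exists u, [/\ J u, t < u & H t - e < H u] }.

Lemma itv0_gt t : J t -> exists2 u, J u & t < u.
Proof.
move=> [t0 tb]; have [u [tu ub]] : exists u : R, t < u /\ (u%:E < b)%E.
  move: tb; rewrite /J; case: b => [c| |//]; rewrite ?lte_fin => tc.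
    by exists ((t + c) / 2); rewrite lte_fin; split; lra.
  by exists (t + 1); rewrite ltry; split => //; lra.
by exists u => //; split => //; exact: lt_trans tu.
Qed.

Lemma rc_nonincreasing0 : rc_nonincreasing (fun=> 0).
Proof.
split=> // t e Jt e0; have [u Ju tu] := itv0_gt Jt.
by exists u; split => //; rewrite subr_lt0.
Qed.

Lemma rc_nonincreasingD H K : rc_nonincreasing H -> rc_nonincreasing K ->
  rc_nonincreasing (fun t => H t + K t).
Proof.
move=> [H0 Ha Hr] [K0 Ka Kr]; split.
- by move=> t Jt; rewrite addr_ge0 ?H0 ?K0.
- by move=> s t Js Jt st; rewrite lerD ?Ha ?Ka.
move=> t e Jt e0; have e20 : 0 < e / 2 by rewrite divr_gt0.
have [u [Ju tu Hu]] := Hr t _ Jt e20; have [v [Jv tv Kv]] := Kr t _ Jt e20.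
pose m := Num.min u v.
have Jm : J m by rewrite /m; case: ltP.
exists m; split => //; first by rewrite lt_min tu.
have Hm : H u <= H m by apply: Ha => //; rewrite ge_min lexx.
have Km : K v <= K m by apply: Ka => //; rewrite ge_min lexx orbT.
lra.
Qed.

Lemma rc_nonincreasingZ (c : R) H : 0 <= c -> rc_nonincreasing H ->
  rc_nonincreasing (fun t => c * H t).
Proof.
move=> c0 [H0 Ha Hr]; split.
- by move=> t Jt; rewrite mulr_ge0// H0.
- by move=> s t Js Jt st; rewrite ler_wpM2l// Ha.
(* Dividing by [c + 1] instead of [c] covers [c = 0]. *)
move=> t e Jt e0; have c10 : 0 < c + 1 by rewrite ltr_wpDl.
have [u [Ju tu Hu]] := Hr t (e / (c + 1)) Jt (divr_gt0 e0 c10).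
exists u; split => //.
have : c * (H t - e / (c + 1)) <= c * H u by rewrite ler_wpM2l// ltW.
apply: lt_le_trans; rewrite mulrBr ltrD2l ltrN2 mulrA ltr_pdivrMr//.
by rewrite mulrDr mulr1 mulrC ltrDl.
Qed.

Lemma rc_nonincreasing_sum n (H : 'I_n -> R -> R) :
  (forall i, rc_nonincreasing (H i)) ->
  rc_nonincreasing (fun t => \sum_(i < n) H i t).
Proof.
elim: n H => [|n IH] H rH.
  by under eq_fun do rewrite big_ord0; exact: rc_nonincreasing0.
under eq_fun do rewrite big_ord_recl.
by apply: rc_nonincreasingD => //; exact: IH.
Qed.

Lemma L0_nonincreasing H :
  (forall s t, J s -> J t -> s <= t -> H t <= H s) -> L0 J H.
Proof. exact/nonincreasing_measurableR/is_interval_itv0. Qed.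

Local Open Scope ereal_scope.

(** The set where [H] exceeds [H t + e] lies inside (0,t), of measure t. The inequality can be
    strict at a jump. *)
Lemma rearrangement_nonincreasing_le H t :
  (forall s, J s -> 0 <= H s)%R ->
  (forall s t, J s -> J t -> s <= t -> H t <= H s)%R -> J t ->
  rearrangement (@leb R) J H t <= (H t)%:E.
Proof.
move=> H0 Ha Jt; apply/lee_addgt0Pr => e e0; apply: ereal_inf_lbound.
exists (H t + e)%R => //; split; first by rewrite ltr_wpDl// H0.
rewrite -(leb_itv0 (ltW Jt.1)); apply: (le_measure (@leb R)); rewrite ?inE.
- by apply: measurable_superlevel; [exact: measurable_itv0|exact: L0_nonincreasing].
- exact: measurable_itv0.
move=> s [Js /=]; rewrite ger0_norm ?H0// => Hts; split; first exact: Js.1.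
rewrite lte_fin ltNge; apply/negP => ts; have := Ha _ _ Jt Js ts.
by rewrite leNgt (lt_trans _ Hts)// ltrDl.
Qed.

(** If the rearrangement at [t] were some r < [H t], right-continuity would give [u > t] with
    [H u > r]. Then [H > r] on (0,u), of measure above t, and [lt_rearrangement] yields r < r. *)
Lemma rearrangement_rc_ge H t : rc_nonincreasing H -> J t ->
  (H t)%:E <= rearrangement (@leb R) J H t.
Proof.
move=> [H0 Ha Hr] Jt; rewrite leNgt; apply/negP.
have mH := L0_nonincreasing Ha; have mJ : measurable (J : set (lebesgueT R)).
  exact: measurable_itv0.
rewrite rearrangement_wdm1//; set r := rearrangement _ _ _ _ => rH.
have r0 : 0 <= r by exact: rearrangement_ge0.
have rfin : r \is a fin_num by rewrite ge0_fin_numE// (lt_trans rH)// ltry.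
have re0 : (0 < H t - fine r)%R by rewrite subr_gt0 -lte_fin fineK.
have [u [Ju tu]] := Hr t _ Jt re0; rewrite subKr => ru.
suff : (fine r)%:E < r by rewrite fineK// ltxx.
have mc : measurable_fun (J : set (lebesgueT R)) ((fun=> 1%R) : lebesgueT R -> R).
  exact: measurable_cst.
rewrite /r (lt_rearrangement mJ mc (fun _ _ => ler01) t mH (fine_ge0 r0)).
rewrite /Defs.distribution wdm1; last exact: measurable_superlevel.
apply: (@lt_le_trans _ _ (@leb R (itv0 u%:E))).
  by rewrite leb_itv0 ?ltW ?Ju.1// lte_fin.
apply: (le_measure (@leb R)); rewrite ?inE.
- exact: measurable_itv0.
- exact: measurable_superlevel.
move=> s [s0 su]; have Js : J s by split => //; exact: lt_trans Ju.2.
split => //=; rewrite (lt_le_trans ru)// ger0_norm ?H0// Ha// ltW//.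
Qed.

(** Turns an inequality between plain integrals into the relation on which full symmetry acts: K^*
    is bounded above by K and H^* below by H, so right-continuity is asked of the majorant only. *)
Lemma submajorized_rc H K : rc_nonincreasing H ->
  (forall s, J s -> 0 <= K s)%R ->
  (forall s t, J s -> J t -> s <= t -> K t <= K s)%R ->
  (forall x, J x -> \int[@leb R]_(t in `]0%R, x[) (K t)%:E <=
    \int[@leb R]_(t in `]0%R, x[) (H t)%:E) ->
  submajorized J K H.
Proof.
move=> rH K0 Ka KH x Jx; have [H0 Ha _] := rH.
have sub : [set` `]0%R, x[] `<=` J.
  by rewrite -itv0_fin => s [s0 sx]; split => //; exact: lt_trans Jx.2.
have mx := measurable_itv_lebesgueT `]0%R, x[.
have ix : is_interval ([set` `]0%R, x[] : set R) by exact: interval_is_interval.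
have mJ : measurable (J : set (lebesgueT R)) by exact: measurable_itv0.
have mr G : measurable_fun ([set` `]0%R, x[] : set (lebesgueT R))
    (rearrangement (@leb R) J G : lebesgueT R -> \bar R).
  exact: measurable_rearrangement.
have mE G : (forall s t, J s -> J t -> s <= t -> G t <= G s)%R ->
    measurable_fun ([set` `]0%R, x[] : set (lebesgueT R))
    (EFin \o (G : lebesgueT R -> R)).
  move=> Ga; apply/measurable_EFinP.
  exact: (measurable_funS mJ sub (L0_nonincreasing Ga)).
apply: (@le_trans _ _ (\int[@leb R]_(t in `]0%R, x[) (K t)%:E)).
  apply: (ge0_le_integral (@leb R) mx _ (mr K) (mE _ Ka)).
    by move=> t _; exact: rearrangement_ge0.
  by move=> t /sub; exact: rearrangement_nonincreasing_le.
apply: (le_trans (KH x Jx)).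
apply: (ge0_le_integral (@leb R) mx _ (mE _ Ha) (mr H)).
  by move=> t /sub /H0; rewrite lee_fin.
by move=> t /sub; exact: rearrangement_rc_ge.
Qed.

Context (E : set (R -> R)) (N : (R -> R) -> R) (EN : fully_symmetric J E N).

(* If the integral diverged near 0, every function would be submajorized by [H],
   so [N (c * 1_A)] would stay bounded by [N H] for all [c]. *)
Lemma rc_integral_lty H x : rc_nonincreasing H -> E H -> J x ->
  \int[@leb R]_(t in `]0%R, x[) (H t)%:E < +oo.
Proof.
move=> rH EH Jx; have [H0 Ha _] := rH.
have subJ (y : R) : J y -> [set` `]0%R, y[] `<=` J.
  by rewrite -itv0_fin => Jy s [s0 sx]; split => //; exact: lt_trans Jy.2.
have mJ : measurable (J : set (lebesgueT R)) by exact: measurable_itv0.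
have mE (A : set R) : A `<=` J -> measurable_fun (A : set (lebesgueT R))
    (EFin \o (H : lebesgueT R -> R)).
  move=> AJ; apply/measurable_EFinP.
  exact: (measurable_funS mJ AJ (L0_nonincreasing Ha)).
have mI (i : interval R) := measurable_itv_lebesgueT i.
rewrite ltey; apply/negP => /eqP Hoo.
(* The divergence sits at 0: on [[y, x[] the function is at most [H y], so removing that part leaves
   an infinite integral over (0,y). *)
have Hooy y : J y -> \int[@leb R]_(t in `]0%R, y[) (H t)%:E = +oo.
  move=> Jy; have [xy|yx] := leP x y.
    apply/eqP; rewrite -leye_eq -Hoo.
    apply: (ge0_subset_integral (@leb R) (mI _) (mI _) (mE _ (subJ y Jy))).
      by move=> t /(subJ y Jy)/H0; rewrite lee_fin.
    by move=> t /=; rewrite !in_itv/= => /andP[-> /lt_le_trans ->].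
  have sub2 : [set` `[y, x[] `<=` J.
    move=> t /=; rewrite in_itv/= => /andP[yt tx]; split.
      by apply: (lt_le_trans Jy.1).
    by apply: lt_trans Jx.2; rewrite lte_fin.
  have U : [set` `]0%R, x[] = [set` `]0%R, y[] `|` [set` `[y, x[].
    apply/seteqP; split => t /=; rewrite !in_itv/=.
      by move=> /andP[-> ->]; case: (ltP t y); [left|right].
    move=> [/andP[-> /lt_trans ->//]|/andP[yt ->]]; rewrite andbT.
    by apply: (lt_le_trans Jy.1).
  have mU := mE _ (subJ x Jx); rewrite U in mU.
  have disj : [disjoint [set` `]0%R, y[] & [set` `[y, x[]].
    apply/disj_setPLR => t /=; rewrite !in_itv/= => /andP[_ ty].
    by apply/negP; rewrite negb_and -ltNge ty.
  have U0 t : ([set` `]0%R, y[] `|` [set` `[y, x[]) t -> 0 <= (H t)%:E.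
    by rewrite -U => /(subJ x Jx)/H0; rewrite lee_fin.
  move: Hoo; rewrite U (ge0_integral_setU (@leb R) (mI _) (mI _) mU U0 disj).
  move=> Hoo; apply/eqP; rewrite -leye_eq leNgt; apply/negP => lty.
  suff : \int[@leb R]_(t in `[y, x[) (H t)%:E < +oo.
    by move=> lty2; have := lte_add_pinfty lty lty2; rewrite Hoo ltxx.
  apply: (@le_lt_trans _ _ (\int[@leb R]_(t in `[y, x[) cst (H y)%:E t)).
    apply: (ge0_le_integral (@leb R) (mI _) _ (mE _ sub2)).
    - by move=> t /sub2/H0; rewrite lee_fin.
    - exact: measurable_cst.
    move=> t tyx; rewrite lee_fin Ha//; first exact: sub2.
    by move: tyx => /=; rewrite in_itv/= => /andP[].
  rewrite (integral_cst_leb _ (mI _)).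
  by rewrite [leb _](lebesgue_measure_itv `[y, x[)/= lte_fin yx -EFinB -EFinM ltry.
have [[ELS _ [N0 N00 NZ _ _] _ Esup] _ Esub] := EN.
pose A := itv0 x%:E; pose u : R -> R := \1_A.
have mA : measurable (A : set (lebesgueT R)) by exact: measurable_itv0.
have Aoo : @leb R A < +oo by rewrite leb_itv0 ?ltW ?Jx.1 ?ltry.
have AJ : A `<=` J by rewrite /A itv0_fin; exact: subJ.
have Eu : E u by exact: Esup.
have cu (c : R) : (0 < c)%R -> (c * N u <= N H)%R.
  move=> c0; rewrite -(gtr0_norm c0) -(NZ _ _ Eu).
  have Ecu := subspaceZ ELS c Eu.
  apply: (Esub _ _ (subspace_L0 ELS Ecu) EH _).2 => y Jy.
  rewrite (_ : \int[@leb R]_(t in _) rearrangement _ _ H t = +oo) ?leey//.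
  apply/eqP; rewrite -leye_eq -(Hooy y Jy).
  apply: (ge0_le_integral (@leb R) (mI _) _ (mE _ (subJ y Jy))).
  - by move=> t /(subJ y Jy)/H0; rewrite lee_fin.
  - by apply: measurable_rearrangement; exact: interval_is_interval.
  by move=> t /(subJ y Jy); exact: rearrangement_rc_ge.
have Nu : N u = 0%R.
  apply/eqP; rewrite eq_le N0// andbT leNgt; apply/negP => Nu0.
  have NH0 := N0 _ EH.
  have c0 : (0 < (N H + 1) / N u)%R by rewrite divr_gt0// ltr_wpDl.
  have := cu _ c0; rewrite mulfVK ?gt_eqF//.
  by rewrite leNgt ltrDl ltr01.
have /N00[/(_ Nu) u0 _] := Eu.
have : (@leb R).-negligible A.
  apply: negligibleS u0 => t At /= /(_ (AJ t At)) /eqP.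
  by rewrite /u indicE mem_set// oner_eq0.
move=> /(leb_negligible mA).
have -> : @leb R A = x%:E by apply: leb_itv0; exact: ltW Jx.1.
by move=> [x0]; move: Jx.1; rewrite x0 ltxx.
Qed.

End FullySymmetric.

(** * Finiteness and right-continuity of rearrangements *)

Section RearrangementFinite.
Context {R : realType}.
Implicit Types (D : set R) (w f : R -> R) (t x : R).
Local Open Scope ereal_scope.

(** (0,t) has positive measure, so an a.e. property is met somewhere to the left of [t]. For
    nonincreasing functions this upgrades a.e. finiteness to finiteness everywhere. *)
Lemma ae_on_witness (c : \bar R) (P : R -> Prop) t :
  itv0 c t -> ae_on (itv0 c) P -> exists2 s, itv0 t%:E s & P s.
Proof.
move=> ct aeP; apply: contrapT => nP.
have mt := measurable_itv0 (t%:E : \bar R).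
suff /(leb_negligible mt) : (@leb R).-negligible (itv0 t%:E).
  by rewrite leb_itv0 ?ltW ?ct.1// => -[t0]; move: ct.1; rewrite t0 ltxx.
apply: negligibleS aeP => s ts /= Ps; apply: nP; exists s => //.
by apply: Ps; split; [exact: ts.1|exact: lt_trans ts.2 ct.2].
Qed.

(** An infinite value at [x] would spread to all of (0,x) by monotonicity and make the integral
    infinite. *)
Lemma rearrangement_fin_num (mu : set R -> \bar R) D f x : (0 < x)%R ->
  \int[@leb R]_(t in `]0%R, x[) rearrangement mu D f t < +oo ->
  rearrangement mu D f x \is a fin_num.
Proof.
move=> x0; have mx := measurable_itv_lebesgueT `]0%R, x[.
have ix : is_interval ([set` `]0%R, x[] : set R) by exact: interval_is_interval.
rewrite ge0_fin_numE; last exact: rearrangement_ge0.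
rewrite !ltey; apply: contraNN => /eqP rx; rewrite -leye_eq.
apply: (@le_trans _ _ (\int[@leb R]_(t in `]0%R, x[) cst +oo t)).
  rewrite (integral_cst_leb _ mx) -itv0_fin (leb_itv0 (ltW x0)).
  by rewrite gt0_mulye ?lte_fin.
apply: (ge0_le_integral (@leb R) mx).
- by move=> t _; exact: leey.
- exact: measurable_cst.
- exact: measurable_rearrangement.
by move=> t /=; rewrite in_itv/= => /andP[_ /ltW tx]; rewrite -rx le_rearrangement.
Qed.

(** f^{*,w}(t) > r means t < d(r), which persists slightly to the right of t; as d(r) is at most the
    total mass, the new point stays in the domain. Negative r are treated apart because the
    equivalence asks for [0 <= r]. *)
Lemma rc_rearrangement D w f : measurable (D : set (lebesgueT R)) ->
  measurable_fun (D : set (lebesgueT R)) (w : lebesgueT R -> R) ->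
  (forall x, D x -> 0 <= w x)%R -> L0 D f ->
  (forall t, itv0 (wdm w D) t ->
    rearrangement (wdm w) D f t \is a fin_num) ->
  rc_nonincreasing (wdm w D) (fun t => fine (rearrangement (wdm w) D f t)).
Proof.
move=> mD mw w0 mf fin; split.
- by move=> t Jt; rewrite fine_ge0//; exact: rearrangement_ge0.
- by move=> s t Js Jt st; rewrite fine_le ?fin//; exact: le_rearrangement.
move=> t e Jt e0; set r := (fine _ - e)%R.
have [r0|r0] := ltP r 0%R.
  have [u Ju tu] := itv0_gt Jt; exists u; split => //.
  by rewrite (lt_le_trans r0)// fine_ge0//; exact: rearrangement_ge0.
have : r%:E < rearrangement (wdm w) D f t.
  by rewrite -[ltRHS]fineK ?fin// lte_fin /r ltrBlDr ltrDl.
rewrite (lt_rearrangement mD mw w0)// => td.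
have dw : Defs.distribution (wdm w) D f r <= wdm w D.
  have md := measurable_superlevel mD r mf.
  exact: (le_wdm mD mw w0 md mD (@subIsetl _ _ _) (@subset_refl _ _)).
have Kt : itv0 (Defs.distribution (wdm w) D f r) t by split => //; exact: Jt.1.
have [u Ku tu] := itv0_gt Kt.
have Ju : itv0 (wdm w D) u by split; [exact: Ku.1|exact: lt_le_trans Ku.2 dw].
exists u; split => //; rewrite -lte_fin fineK ?fin//.
by rewrite (lt_rearrangement mD mw w0)//; exact: Ku.2.
Qed.

End RearrangementFinite.

(** * The main inequality for finite families in [MEw] *)

Section MainInequality.
Context {R : realType} (a : \bar R) (w : R -> R).
Context (E : set (R -> R)) (N : (R -> R) -> R) (C : R).
Context (a_gt0 : (0 < a)%E).
Context (w_gt0 : forall t, itv0 a t -> 0 < w t).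
Context (w_decr : forall s t, itv0 a s -> itv0 a t -> s <= t -> w t <= w s).
Context (E_fsym : fully_symmetric (itv0 (wdm w (itv0 a))) E N).
Context (C_ge1 : 1 <= C).
Context (w_regular : forall t, itv0 a t ->
  (wdm w (itv0 t%:E) <= (C * t * w t)%:E)%E).

Let I := itv0 a.
Let b := wdm w I.
Let J := itv0 b.
(** [h f] plays the role of k and of the h_i, made real-valued by [fine]; [Rf f] is f^* and [G f] is
    the w-rearrangement of [h f]. *)
Let h f t := fine (star_over_w a w f t).
Let Rf f := rearrangement (@leb R) I f.
Let G f := rearrangement (wdm w) I (h f).

Let mI : measurable (I : set (lebesgueT R)).
Proof. exact: measurable_itv0. Qed.

Let iI : is_interval I.
Proof. exact: is_interval_itv0. Qed.

Let mw : measurable_fun (I : set (lebesgueT R)) (w : lebesgueT R -> R).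
Proof. exact: nonincreasing_measurableR. Qed.

Let w0 x : I x -> 0 <= w x.
Proof. by move=> /w_gt0/ltW. Qed.

Let C0 : 0 <= C.
Proof. exact: le_trans C_ge1. Qed.

Let subI (t : R) : I t -> itv0 t%:E `<=` I.
Proof. by move=> [_ ta] x [x0 xt]; split => //; exact: lt_trans ta. Qed.

Local Open Scope ereal_scope.

Let wdm_fin t : I t -> wdm w (itv0 t%:E) \is a fin_num.
Proof.
move=> It; rewrite ge0_fin_numE; last by apply: (wdm_ge0 w0); exact: subI.
by apply: le_lt_trans (w_regular It) _; rewrite ltry.
Qed.

(** [w] is at least [w t] on (0,t). This makes J nonempty, so that there is a point x at which
    levels can be taken. *)
Lemma wdm_gt0 : 0 < b.
Proof.
have [t It] := itv0_neq0 a_gt0; have mt := measurable_itv0 (t%:E : \bar R).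
apply: (@lt_le_trans _ _ (w t * t)%:E); first by rewrite lte_fin mulr_gt0// ?w_gt0 ?It.1.
apply: (@le_trans _ _ (wdm w (itv0 t%:E))); last first.
  exact: (le_wdm mI mw w0 mt mI (subI It) (@subset_refl _ _)).
rewrite EFinM -[X in _ * X](leb_itv0 (ltW It.1)) -integral_cst_leb//.
apply: (ge0_le_integral (@leb R) mt).
- by move=> r _; rewrite lee_fin w0.
- exact: measurable_cst.
- by apply/measurable_EFinP; exact: (measurable_funS mI (subI It) mw).
move=> r tr; rewrite lee_fin; apply: w_decr => //; first exact: subI tr.
by rewrite ltW// -lte_fin; exact: tr.2.
Qed.

Let star_fin f t : I t -> Rf f t \is a fin_num ->
  star_over_w a w f t = (fine (Rf f t) / w t)%:E.
Proof. by move=> It fin; rewrite /star_over_w EFinM fineK. Qed.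

(** f^*/w is finite at some s < t; since w(s) > 0, so is f^*(s), which bounds f^*(t). *)
Lemma MEw_rearrangement_fin f t : MEw a w E f -> I t -> Rf f t \is a fin_num.
Proof.
move=> [_ [fin _]] It; have [s ts sfin] := ae_on_witness It fin.
have Is := subI It ts.
have sw : ((w s)^-1)%:E != 0 by rewrite eqe invr_eq0 gt_eqF// w_gt0.
rewrite ge0_fin_numE; last exact: rearrangement_ge0.
apply: (@le_lt_trans _ _ (Rf f s)).
  by apply: le_rearrangement; rewrite ltW// -lte_fin; exact: ts.2.
move: sfin; rewrite /star_over_w -/(Rf f s).
case: (Rf f s) (rearrangement_ge0 (@leb R) I f s : 0 <= Rf f s) => [r _ _| |//].
  by rewrite ltry.
by rewrite gt0_mulye// lte_fin invr_gt0 w_gt0.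
Qed.

Lemma MEw_weighted_fin f t : MEw a w E f -> J t -> G f t \is a fin_num.
Proof.
move=> [_ [_ [_ [fin _]]]] Jt; have [s ts sfin] := ae_on_witness Jt fin.
rewrite ge0_fin_numE; last exact: rearrangement_ge0.
apply: le_lt_trans (_ : G f s < +oo).
  by apply: le_rearrangement; rewrite ltW// -lte_fin; exact: ts.2.
by rewrite -ge0_fin_numE//; exact: rearrangement_ge0.
Qed.

Lemma MEw_rc f : MEw a w E f -> rc_nonincreasing b (fun t => fine (G f t)).
Proof.
move=> Mf; apply: rc_rearrangement => //; first by case: Mf => _ [_ []].
by move=> t; exact: MEw_weighted_fin.
Qed.

Let excess f s := \int[@leb R]_(y in I) (Num.max (`|h f y| - s) 0 * w y)%:E.

Let h_ge0 f y : I y -> (0 <= h f y)%R.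
Proof.
move=> Iy; rewrite fine_ge0// mule_ge0//; first exact: rearrangement_ge0.
by rewrite lee_fin invr_ge0 w0.
Qed.

(** Pointwise f^* = h w <= s w + (h - s)^+ w. After integration over (0,t) the excess is enlarged to
    all of I, which makes the error independent of [t]. *)
Lemma MEw_rearrangement_le f s t : MEw a w E f -> (0 <= s)%R -> I t ->
  \int[@leb R]_(y in `]0%R, t[) Rf f y <=
  s%:E * wdm w (itv0 t%:E) + excess f s.
Proof.
move=> Mf s0 It; have mt := measurable_itv0 (t%:E : \bar R).
have mh : L0 I (h f) by case: Mf => _ [_ []].
have mex := measurable_maxr0 mw s mh.
have ex0 y : I y -> 0 <= (Num.max (`|h f y| - s) 0 * w y)%:E by exact: maxr0_ge0.
have mwt : measurable_fun (itv0 t%:E : set (lebesgueT R))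
    (EFin \o (w : lebesgueT R -> R)).
  by apply/measurable_EFinP; exact: (measurable_funS mI (subI It) mw).
have mext := measurable_funS mI (subI It) mex.
rewrite -itv0_fin.
apply: (@le_trans _ _ (\int[@leb R]_(y in itv0 t%:E) (s%:E * (w y)%:E) +
    \int[@leb R]_(y in itv0 t%:E) (Num.max (`|h f y| - s) 0 * w y)%:E)).
  have mswt : measurable_fun (itv0 t%:E : set (lebesgueT R))
    ((fun y => s%:E * (w y)%:E) : lebesgueT R -> \bar R).
    by apply: emeasurable_funM; [exact: measurable_cst|exact: mwt].
  have sw0 y : itv0 t%:E y -> 0 <= s%:E * (w y)%:E.
    by move=> /(subI It) Iy; rewrite mule_ge0 ?lee_fin ?w0.
  have ext0 y : itv0 t%:E y -> 0 <= (Num.max (`|h f y| - s) 0 * w y)%:E.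
    by move=> /(subI It); exact: ex0.
  rewrite -(ge0_integralD (@leb R) mt sw0 mswt ext0 mext).
  apply: (ge0_le_integral (@leb R) mt).
  - by move=> y _; exact: rearrangement_ge0.
  - by apply: measurable_rearrangement; exact: is_interval_itv0.
  - by apply: emeasurable_funD; [exact: mswt|exact: mext].
  move=> y /(subI It) Iy; have fin := MEw_rearrangement_fin Mf Iy.
  have -> : Rf f y = (h f y * w y)%:E.
    by rewrite /h (star_fin Iy fin)/= divfK ?fineK// gt_eqF// w_gt0.
  rewrite -EFinM -EFinD lee_fin -mulrDl ler_wpM2r ?w0//.
  by rewrite ger0_norm ?h_ge0// -lerBlDl le_max lexx.
apply: leeD.
  rewrite le_eqVlt; apply/orP; left; apply/eqP.
  apply: (ge0_integralZl (@leb R) mt mwt); last by rewrite lee_fin.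
  by move=> y /(subI It) Iy; rewrite lee_fin w0.
exact: (ge0_subset_integral (@leb R) mt mI mex ex0 (subI It)).
Qed.

Section Sums.
Context (n : nat) (f : R -> R) (F : 'I_n -> R -> R).
Context (mf : L0 I f) (MF : forall i, MEw a w E (F i)).
Context (fF : ae_on I (fun y => `|f y| <= \sum_(i < n) `|F i y|)%R).

Let s x i := fine (G (F i) x).

Let s0 x i : (0 <= s x i)%R.
Proof. by rewrite fine_ge0//; exact: rearrangement_ge0. Qed.

Let excess_ge0 g r : 0 <= excess g r.
Proof. by apply: integral_ge0 => y Iy; exact: (maxr0_ge0 w0 (h g) r Iy). Qed.

Let excess_le i x : J x ->
  (s x i * x)%:E + excess (F i) (s x i) <=
  \int[@leb R]_(t in `]0%R, x[) (fine (G (F i) t))%:E.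
Proof.
move=> Jx; have mh : L0 I (h (F i)) by case: (MF i) => _ [_ []].
have fin := MEw_weighted_fin (MF i) Jx.
apply: (le_trans (le_integral_rearrangement mI mw w0 mh (ltW Jx.1) _)).
  by rewrite /s fineK.
rewrite le_eqVlt; apply/orP; left; apply/eqP; apply: eq_integral => t.
rewrite inE/= in_itv/= => /andP[t0 tx]; rewrite fineK//.
apply: MEw_weighted_fin => //; split => //.
by apply: lt_trans Jx.2; rewrite lte_fin.
Qed.

(** Full symmetry enters here: the w-rearrangement of h_i lies in E, so its integral over (0,x) is
    finite, and that integral bounds the excess. *)
Let excess_fin i x : J x -> excess (F i) (s x i) \is a fin_num.
Proof.
move=> Jx; rewrite ge0_fin_numE//.
have EG : E (fun t => fine (G (F i) t)) by case: (MF i) => _ [_ [_ []]].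
have := rc_integral_lty E_fsym (MEw_rc (MF i)) EG Jx.
apply: le_lt_trans; apply: le_trans (excess_le i Jx).
by rewrite leeDr// lee_fin mulr_ge0// ltW// Jx.1.
Qed.

Let B x := (\sum_(i < n) fine (excess (F i) (s x i)))%R.

Let B0 x : (0 <= B x)%R.
Proof. by apply: sumr_ge0 => i _; rewrite fine_ge0. Qed.

Let ss x := (\sum_(i < n) s x i)%R.

Let ss0 x : (0 <= ss x)%R.
Proof. by apply: sumr_ge0 => i _; exact: s0. Qed.

(** [x] and [t] are independent: unweighted subadditivity acts at [t], while all levels are set by
    [x]. One pair [ss x], [B x] thus serves every [t] in I. *)
Let integral_Rf_le x t : J x -> I t ->
  \int[@leb R]_(y in `]0%R, t[) Rf f y <=
  (ss x)%:E * wdm w (itv0 t%:E) + (B x)%:E.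
Proof.
move=> Jx It; have t0 := ltW It.1.
have mc : measurable_fun (I : set (lebesgueT R)) ((fun=> 1%R) : lebesgueT R -> R).
  exact: measurable_cst.
have mF i : L0 I (F i) by case: (MF i).
have Ffin i : rearrangement (wdm (fun=> 1%R)) I (F i) t \is a fin_num.
  by rewrite -rearrangement_wdm1//; exact: MEw_rearrangement_fin.
rewrite /Rf rearrangement_wdm1//.
apply: (le_trans (submajorized_sum mI mc (fun _ _ => ler01) mf mF fF t0 Ffin)).
apply: (@le_trans _ _ (\sum_(i < n) ((s x i)%:E * wdm w (itv0 t%:E) +
    excess (F i) (s x i)))).
  apply: lee_sum => i _; rewrite -rearrangement_wdm1//.
  exact: MEw_rearrangement_le.
rewrite -(fineK (wdm_fin It)) -EFinM -EFinD /ss /B mulr_suml -big_split/=.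
rewrite -sumEFin; apply: lee_sum => i _.
by rewrite EFinD EFinM (fineK (excess_fin i Jx)).
Qed.

(** Membership of [f] in [MEw] is still to be proved; the bound at a single x of J already makes the
    integral of f^* finite. *)
Let Rf_fin t : I t -> Rf f t \is a fin_num.
Proof.
move=> It; have [x Jx] := itv0_neq0 wdm_gt0.
apply: (rearrangement_fin_num It.1); apply: le_lt_trans (integral_Rf_le Jx It) _.
by rewrite -(fineK (wdm_fin It)) -EFinM -EFinD ltry.
Qed.

Let Fr t := fine (Rf f t).

Let Fr_anti r t : I r -> I t -> (r <= t)%R -> (Fr t <= Fr r)%R.
Proof.
by move=> Ir It rt; rewrite fine_le ?Rf_fin//; exact: le_rearrangement.
Qed.

Let hE t : I t -> h f t = (Fr t / w t)%R.
Proof. by move=> It; rewrite /h star_fin// Rf_fin. Qed.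

Let mh : L0 I (h f).
Proof.
have mIV : measurable_fun (I : set (lebesgueT R))
    ((fun t => (w t)^-1%R) : lebesgueT R -> R).
  (* Since [w] decreases, it is -1/w that decreases and falls under the monotone criterion. *)
  have mN : measurable_fun (I : set (lebesgueT R))
      ((fun t => - (w t)^-1)%R : lebesgueT R -> R).
    apply: nonincreasing_measurableR => // r t Ir It rt.
    by rewrite lerN2 lef_pV2 ?posrE ?w_gt0//; exact: w_decr.
  have := measurableT_comp (@oppr_measurable R setT) mN.
  by apply: eq_measurable_fun => t _ /=; rewrite opprK.
have mFr := nonincreasing_measurableR iI Fr_anti.
have : measurable_fun (I : set (lebesgueT R))
    ((fun t => Fr t * (w t)^-1)%R : lebesgueT R -> R).
  exact: measurable_funM.
by apply: eq_measurable_fun => t; rewrite inE => It; rewrite hE.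
Qed.

(** Multiplying by the weight turns (k - C s)^+ w into (f^* - C s w)^+, the form bounded by
    [integral_maxr_itv0_le] with v = s w. *)
Let excess_f x : J x -> excess f (C * ss x) <= (B x)%:E.
Proof.
move=> Jx; rewrite /excess.
rewrite [leLHS](_ : _ =
    \int[@leb R]_(r in I) (Num.max (Fr r - C * (ss x * w r)) 0)%:E); last first.
  apply: eq_integral => y; rewrite inE => Iy; congr EFin.
  have wy := w_gt0 Iy.
  rewrite ger0_norm ?h_ge0// maxr_pMl ?w0// mul0r hE// mulrBl divfK ?gt_eqF//.
  by rewrite mulrA.
have wssE t : I t -> wdm (fun r => ss x * w r)%R (itv0 t%:E) =
    (ss x)%:E * wdm w (itv0 t%:E).
  move=> It; have mt := measurable_itv0 (t%:E : \bar R).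
  have mwt : measurable_fun (itv0 t%:E : set (lebesgueT R))
      (EFin \o (w : lebesgueT R -> R)).
    by apply/measurable_EFinP; exact: (measurable_funS mI (subI It) mw).
  rewrite /wdm; under eq_integral do rewrite EFinM.
  apply: (ge0_integralZl (@leb R) mt mwt); last by rewrite lee_fin.
  by move=> y /(subI It) Iy; rewrite lee_fin w0.
apply: integral_maxr_itv0_le => //.
- by move=> r t Ir It rt; rewrite ler_wpM2l// w_decr.
- by move=> t It; rewrite fine_ge0//; exact: rearrangement_ge0.
- by move=> t It; rewrite mulr_ge0// w0.
- move=> t It; rewrite wssE//.
  apply: (@le_trans _ _ ((ss x)%:E * (C * t * w t)%:E)).
    by apply: lee_wpmul2l; rewrite ?lee_fin// w_regular.
  by rewrite -EFinM lee_fin mulrCA.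
move=> t It; rewrite wssE//; apply: le_trans (integral_Rf_le Jx It).
rewrite -itv0_fin le_eqVlt; apply/orP; left; apply/eqP.
by apply: eq_integral => r; rewrite inE => tr; rewrite fineK// Rf_fin//; exact: subI tr.
Qed.

Let integral_G_le x : J x ->
  \int[@leb R]_(t in `]0%R, x[) G f t <= C%:E *
  \sum_(i < n) \int[@leb R]_(t in `]0%R, x[) (fine (G (F i) t))%:E.
Proof.
move=> Jx; have Css0 : (0 <= C * ss x)%R by exact: mulr_ge0.
apply: (le_trans (integral_rearrangement_le mI mw w0 mh Css0 (ltW Jx.1))).
apply: (@le_trans _ _ ((C * ss x * x)%:E + (B x)%:E)).
  by apply: leeD => //; exact: excess_f.
(* Here [1 <= C] absorbs [B x] into [C * B x], so that one constant governs both terms. *)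
apply: (@le_trans _ _ (C * (ss x * x + B x))%:E).
  by rewrite -EFinD lee_fin mulrDr mulrA lerD2l ler_peMl.
rewrite EFinM; apply: lee_wpmul2l; first by rewrite lee_fin.
rewrite /ss /B mulr_suml -big_split/= -sumEFin; apply: lee_sum => i _.
by rewrite EFinD (fineK (excess_fin i Jx)); exact: excess_le.
Qed.

Let G_fin x : J x -> G f x \is a fin_num.
Proof.
move=> Jx; apply: (rearrangement_fin_num Jx.1).
apply: le_lt_trans (integral_G_le Jx) _; rewrite lte_mul_pinfty ?lee_fin//.
apply: lte_sum_pinfty => i _.
have EG : E (fun t => fine (G (F i) t)) by case: (MF i) => _ [_ [_ []]].
exact: (rc_integral_lty E_fsym (MEw_rc (MF i)) EG Jx).
Qed.

(** The majorant [H] is right-continuous and lies in E, so full symmetry yields membership and the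
    norm bound at once. The family may be empty or repeat a function, which later supplies the
    linear structure. *)
Lemma MEw_sum_le : MEw a w E f /\
  (MEw_gauge a w N f <= C * \sum_(i < n) MEw_gauge a w N (F i))%R.
Proof.
pose H t := (C * \sum_(i < n) fine (G (F i) t))%R.
have rH : rc_nonincreasing b H.
  apply: rc_nonincreasingZ => //; apply: rc_nonincreasing_sum => i.
  exact: MEw_rc.
have [[ELS _ [N_ge0 N0 NZ ND _] _ _] _ Esub] := E_fsym.
have EG i : E (fun t => fine (G (F i) t)) by case: (MF i) => _ [_ [_ []]].
have ES (r : seq 'I_n) : E (fun t => \sum_(i <- r) fine (G (F i) t))%R /\
    (N (fun t => \sum_(i <- r) fine (G (F i) t)) <=
     \sum_(i <- r) MEw_gauge a w N (F i))%R.
  elim: r => [|i r [IH1 IH2]].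
    under eq_fun do rewrite big_nil; rewrite big_nil; split.
      exact: (subspace0 ELS).
    by rewrite (N0 _ (subspace0 ELS)).2//; apply: ae_onW.
  under eq_fun do rewrite big_cons; rewrite big_cons; split.
    exact: (subspaceD ELS (EG i) IH1).
  by apply: le_trans (ND _ _ _ _) _ => //; rewrite lerD2l.
have [EHs NHs] := ES (index_enum _).
have EH : E H by exact: (subspaceZ ELS).
have rK : rc_nonincreasing b (fun t => fine (G f t)).
  exact: rc_rearrangement mI mw w0 mh G_fin.
have [K0 Ka _] := rK.
have KH : submajorized J (fun t => fine (G f t)) H.
  apply: submajorized_rc => // x Jx.
  have subJ t : [set` `]0%R, x[] t -> J t.
    by rewrite /= in_itv/= => /andP[t0 tx]; split => //; apply: lt_trans Jx.2.
  rewrite [leLHS](_ : _ =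
      \int[@leb R]_(t in `]0%R, x[) G f t); last first.
    by apply: eq_integral => t; rewrite inE => /subJ Jt; rewrite fineK// G_fin.
  apply: (le_trans (integral_G_le Jx)).
  have sub : [set` `]0%R, x[] `<=` J by move=> t; exact: subJ.
  have mx := measurable_itv_lebesgueT `]0%R, x[.
  have mJ : measurable (J : set (lebesgueT R)) by exact: measurable_itv0.
  have rG i := MEw_rc (MF i).
  have mG i : measurable_fun ([set` `]0%R, x[] : set (lebesgueT R))
      ((fun t => (fine (G (F i) t))%:E) : lebesgueT R -> \bar R).
    apply/measurable_EFinP.
    exact: (measurable_funS mJ sub (L0_nonincreasing (rc_anti (rG i)))).
  have G0 i t : [set` `]0%R, x[] t -> 0 <= (fine (G (F i) t))%:E.
    by move=> tx; rewrite lee_fin fine_ge0//; exact: rearrangement_ge0.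
  rewrite -(ge0_integral_sum (@leb R) mx mG G0).
  rewrite -(ge0_integralZl (@leb R) mx); last 3 first.
  - by apply: emeasurable_sum => i; exact: mG.
  - by move=> t tx; apply: sume_ge0 => i _; exact: G0.
  - by rewrite lee_fin.
  by under eq_integral do rewrite sumEFin -EFinM.
have [EK NK] := Esub _ _ (L0_nonincreasing Ka) EH KH.
split; last first.
  apply: (le_trans NK); rewrite NZ// ger0_norm//.
  by rewrite ler_wpM2l.
split => //; split.
  by apply: ae_onW => t It; rewrite star_fin// Rf_fin.
split => //; split => //.
by apply: ae_onW => t Jt; exact: G_fin.
Qed.

End Sums.

End MainInequality.

(** * Homogeneity of the gauge *)

Section GaugeHomogeneity.
Context {R : realType}.

(** [fine] sends both infinities to 0, so the identity survives there and homogeneity of the gauge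
    calls for no finiteness check. *)
Lemma fine_mulr (c : R) (x : \bar R) : 0 < c -> fine (c%:E * x)%E = c * fine x.
Proof.
move=> c0; case: x => [x//| |].
  by rewrite gt0_muley ?lte_fin//= mulr0.
by rewrite gt0_muleNy ?lte_fin//= mulr0.
Qed.

Lemma rearrangementZ (mu : set R -> \bar R) (D : set R) (f : R -> R) (c t : R) :
  c != 0 ->
  rearrangement mu D (fun x => c * f x) t =
  (`|c|%:E * rearrangement mu D f t)%E.
Proof.
move=> cn0; have c0 : 0 < `|c| by rewrite normr_gt0.
have dE s : Defs.distribution mu D (fun x => c * f x) (`|c| * s) =
    Defs.distribution mu D f s.
  by rewrite /Defs.distribution; congr (mu (_ `&` _)); apply/seteqP; split => x /=;
    rewrite normrM ltr_pM2l.
rewrite /rearrangement -ereal_inf_pZl//; congr ereal_inf; apply/seteqP; split.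
  move=> _ [s [s0 sd] <-]; exists (s / `|c|)%:E; last first.
    by rewrite -EFinM mulrC divfK// gt_eqF.
  exists (s / `|c|) => //; split; first exact: divr_gt0.
  by rewrite -dE mulrC divfK// gt_eqF.
move=> _ [_ [s [s0 sd] <-] <-]; exists (`|c| * s); last by rewrite EFinM.
by split; [exact: mulr_gt0|rewrite dE].
Qed.

(** The gauge rearranges twice, first [f] and then f^*/w, so the factor is pulled out twice. *)
Lemma MEw_gaugeZ (a : \bar R) (w : R -> R) (E : set (R -> R))
    (N : (R -> R) -> R) (c : R) (f : R -> R) :
  lattice_norm (itv0 (wdm w (itv0 a))) E N -> MEw a w E f -> c != 0 ->
  MEw_gauge a w N (fun x => c * f x) = `|c| * MEw_gauge a w N f.
Proof.
move=> [_ _ NZ _ _] [_ [_ [_ [_ EG]]]] cn0.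
have c0 : 0 < `|c| by rewrite normr_gt0.
rewrite /MEw_gauge /Ew_gauge -[X in X * _](ger0_norm (ltW c0)) -NZ//.
congr N; apply/funext => t; rewrite -fine_mulr//; congr fine.
have nn0 : `|c| != 0 by rewrite gt_eqF.
have := rearrangementZ (wdm w) (itv0 a) (fun s => fine (star_over_w a w f s)) t nn0.
rewrite normr_id => <-.
congr (rearrangement _ _ _ t); apply/funext => s.
by rewrite -fine_mulr// /star_over_w rearrangementZ// muleA.
Qed.

End GaugeHomogeneity.

(** * Functions with vanishing rearrangement *)

Section GaugeDefinite.
Context {R : realType}.
Local Open Scope ereal_scope.

(** If [f] were nonzero on a set of positive w-measure, [lt_rearrangement] at level 0 would make its
    rearrangement positive on an initial interval. *)
Lemma rearrangement_eq0 (D : set R) (w f : R -> R) (c : \bar R) :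
  measurable (D : set (lebesgueT R)) ->
  measurable_fun (D : set (lebesgueT R)) (w : lebesgueT R -> R) ->
  (forall x, D x -> 0 <= w x)%R -> L0 D f -> 0 < c ->
  ae_on (itv0 c) (fun t => rearrangement (wdm w) D f t = 0) ->
  wdm w (D `&` [set x | (0 < `|f x|)%R]) = 0.
Proof.
move=> mD mw w0 mf c0 f0; apply/eqP; rewrite eq_le; apply/andP; split; last first.
  by apply: (wdm_ge0 w0); exact: subIsetl.
rewrite leNgt; apply/negP => d0.
have m0 : 0 < mine c (Defs.distribution (wdm w) D f 0) by rewrite lt_min c0.
have [t [t0]] := itv0_neq0 m0; rewrite lt_min => /andP[tc td].
have [s ts] := ae_on_witness (conj t0 tc) f0.
have : 0%:E < rearrangement (wdm w) D f s.
  rewrite (lt_rearrangement mD mw w0)//; apply: lt_trans td; exact: ts.2.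
by move=> + s0; rewrite s0 ltxx.
Qed.

Lemma wdm_eq0 (A : set R) (w : R -> R) : measurable (A : set (lebesgueT R)) ->
  measurable_fun (A : set (lebesgueT R)) (w : lebesgueT R -> R) ->
  (forall x, A x -> 0 < w x)%R -> wdm w A = 0 -> (@leb R).-negligible A.
Proof.
move=> mA mw w0 wA.
have mwE : measurable_fun (A : set (lebesgueT R)) (EFin \o (w : lebesgueT R -> R)).
  exact/measurable_EFinP.
have : \int[@leb R]_(x in A) `|(EFin \o w) x| = 0.
  rewrite -[RHS]wA; apply: eq_integral => x; rewrite inE => /w0 wx.
  by rewrite gee0_abs// lee_fin ltW.
move=> /(ae_eq_integral_abs (@leb R) mA mwE).
apply: negligibleS => x Ax /= /(_ Ax) [wx].
by move: (w0 x Ax); rewrite wx ltxx.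
Qed.

Lemma ae_eq0_superlevel (D : set R) (f : R -> R) :
  (@leb R).-negligible (D `&` [set x | (0 < `|f x|)%R]) ->
  ae_on D (fun x => f x = 0%R).
Proof.
apply: negligibleS => x /= fx; split; first by apply: contrapT => nD; apply: fx.
by rewrite normr_gt0; apply/eqP => fx0; apply: fx.
Qed.

End GaugeDefinite.

(** * The lattice norm and normability *)

Section Proposition.
Context {R : realType} (a : \bar R) (w : R -> R).
Context (E : set (R -> R)) (N : (R -> R) -> R) (C : R).
Context (a_gt0 : (0 < a)%E).
Context (w_gt0 : forall t, itv0 a t -> 0 < w t).
Context (w_decr : forall s t, itv0 a s -> itv0 a t -> s <= t -> w t <= w s).
Context (E_fsym : fully_symmetric (itv0 (wdm w (itv0 a))) E N).
Context (C_ge1 : 1 <= C).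
Context (w_regular : forall t, itv0 a t ->
  (wdm w (itv0 t%:E) <= (C * t * w t)%:E)%E).

Let I := itv0 a.
Let M := MEw a w E.
Let q := MEw_gauge a w N.
Let p := MEw_norm a w E N.
Implicit Types (f g : R -> R).

Let sum_le n f (F : 'I_n -> R -> R) : L0 I f -> (forall i, M (F i)) ->
  ae_on I (fun x => `|f x| <= \sum_(i < n) `|F i x|) ->
  M f /\ q f <= C * \sum_(i < n) q (F i).
Proof. by move=> *; exact: MEw_sum_le. Qed.

Let EN : lattice_norm (itv0 (wdm w I)) E N.
Proof. by case: E_fsym => -[]. Qed.

Let C_gt0 : 0 < C.
Proof. exact: lt_le_trans C_ge1. Qed.

Let q_ge0 f : M f -> 0 <= q f.
Proof. by move=> [_ [_ [_ [_ Ef]]]]; exact: norm_ge0 EN _ Ef. Qed.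

Let mI : measurable (I : set (lebesgueT R)).
Proof. exact: measurable_itv0. Qed.

Let mw : measurable_fun (I : set (lebesgueT R)) (w : lebesgueT R -> R).
Proof. by apply: nonincreasing_measurableR => //; exact: is_interval_itv0. Qed.

(** Vanishing is traced back through both rearrangements: with weight [w] it passes to f^*/w, hence
    to f^*, and with weight 1 from f^* to [f]. Positivity of [w] makes w-null sets Lebesgue null. *)
Lemma MEw_gauge_eq0 f : M f -> q f = 0 -> ae_on I (fun x => f x = 0).
Proof.
move=> Mf qf0; have [mf [_ [mh [_ Ef]]]] := Mf.
have w0 x : I x -> 0 <= w x by move=> /w_gt0/ltW.
have b0 : (0 < wdm w I)%E.
  exact: (wdm_gt0 a_gt0 w_gt0 w_decr).
have /(rearrangement_eq0 mI mw w0 mh b0) h0 : ae_on (itv0 (wdm w I))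
    (fun t => rearrangement (wdm w) I (fun t => fine (star_over_w a w f t)) t = 0%E).
  have := (norm_eq0 EN Ef).1 qf0; rewrite /ae_on; apply: filterS => t + Jt.
  move=> /(_ Jt) t0; rewrite -[LHS]fineK ?t0//.
  exact: (MEw_weighted_fin Mf Jt).
have mA := measurable_superlevel mI 0 mh.
have sA := @subIsetl _ I [set x | 0 < `|fine (star_over_w a w f x)|].
have /ae_eq0_superlevel star0 :=
  wdm_eq0 mA (measurable_funS mI sA mw) (fun x Ax => w_gt0 (sA x Ax)) h0.
have R0 : ae_on I (fun t => rearrangement (wdm (fun=> 1)) I f t = 0%E).
  rewrite /ae_on in star0 *; apply: filterS star0 => t + It => /(_ It).
  have fin := MEw_rearrangement_fin w_gt0 Mf It.
  rewrite -rearrangement_wdm1// /star_over_w -(fineK fin) /= => /eqP.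
  by rewrite mulf_eq0 invr_eq0 (gt_eqF (w_gt0 It)) orbF => /eqP ->.
have mc : measurable_fun (I : set (lebesgueT R)) ((fun=> 1) : lebesgueT R -> R).
  exact: measurable_cst.
have f0 := rearrangement_eq0 mI mc (fun _ _ => ler01) mf a_gt0 R0.
have m0 := measurable_superlevel mI 0 mf.
apply: ae_eq0_superlevel; apply: (wdm_eq0 m0 _ (fun _ _ => ltr01) f0).
exact: measurable_cst.
Qed.

(** Solidity with two majorants; sums, maxima, minima and a.e. modifications all reduce to it. *)
Let MD f g : M f -> M g -> forall k, L0 I k ->
  ae_on I (fun x => `|k x| <= `|f x| + `|g x|) -> M k.
Proof.
move=> Mf Mg k mk kfg; pose F (i : 'I_2) := if i == ord0 then f else g.
have MF i : M (F i) by rewrite /F; case: ifP.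
have kF : ae_on I (fun x => `|k x| <= \sum_(i < 2) `|F i x|).
  rewrite /ae_on in kfg *; apply: filterS kfg => x + Ix => /(_ Ix).
  by rewrite big_ord_recl big_ord1.
exact: (sum_le mk MF kF).1.
Qed.

Lemma MEw_subspace : linear_subspace I M.
Proof.
have M0 : M (fun=> 0).
  (* The empty family dominates 0, so no element of [M] has to be known in advance. *)
  pose F (i : 'I_0) : R -> R := fun=> 0.
  have MF i : M (F i) by have := ltn_ord i; rewrite ltn0.
  have zF : ae_on I (fun x => `|0 : R| <= \sum_(i < 0) `|F i x|).
    by apply: ae_onW => x _; rewrite big_ord0 normr0.
  by apply: (sum_le _ MF zF).1; exact: measurable_cst.
split; [by move=> f []| |exact: M0| |].
- move=> f g Mf mg fg; apply: (MD Mf M0 mg).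
  rewrite /ae_on in fg *; apply: filterS fg => x + Ix => /(_ Ix) ->.
  by rewrite normr0 addr0.
- move=> f g Mf Mg; apply: (MD Mf Mg); last by apply: ae_onW => x _; exact: ler_normD.
  by apply: measurable_funD; [case: Mf|case: Mg].
move=> c f Mf; have mf : L0 I f by case: Mf.
have mcf : L0 I (fun x => c * f x).
  by apply: measurable_funM; [exact: measurable_cst|exact: mf].
(* A scalar multiple is dominated by several copies of [f], their number being an integer above
   |c|. *)
have cF : ae_on I (fun x => `|c * f x| <= \sum_(i < Num.bound `|c|) `|f x|).
  apply: ae_onW => x _; rewrite sumr_const card_ord normrM -mulr_natl ler_wpM2r//.
  by apply: ltW; exact: archi_boundP.
exact: (sum_le mcf (fun=> Mf) cF).1.
Qed.

Let S f := [set r | exists n (F : 'I_n -> R -> R),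
    [/\ (0 < n)%N, forall i, M (F i),
        ae_on I (fun x => `|f x| <= \sum_(i < n) `|F i x|) &
        r = \sum_(i < n) q (F i)]].

Let S_lbound f : has_lbound (S f).
Proof.
exists 0 => _ [n [F [_ MF _ ->]]].
by apply: sumr_ge0 => i _; exact: (q_ge0 (MF i)).
Qed.

Let S_gauge f : M f -> S f (q f).
Proof.
move=> Mf; exists 1%N, (fun=> f); split => //; last by rewrite big_ord1.
by apply: ae_onW => x _; rewrite big_ord1.
Qed.

Let p_le f r : S f r -> p f <= r.
Proof. by move=> Sr; exact: (ge_inf (S_lbound f)). Qed.

Let le_p f x : M f -> (forall r, S f r -> x <= r) -> x <= p f.
Proof. by move=> Mf xS; apply: lb_le_inf => //; exists (q f); exact: S_gauge. Qed.

Lemma MEw_norm_le f : M f -> p f <= q f.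
Proof. by move=> Mf; apply: p_le; exact: S_gauge. Qed.

Lemma MEw_gauge_le f : M f -> q f <= C * p f.
Proof.
move=> Mf; rewrite -ler_pdivrMl//; apply: (le_p Mf) => _ [n [F [_ MF fF ->]]].
by rewrite ler_pdivrMl//; apply: (sum_le _ MF fF).2; case: Mf.
Qed.

Let p_ge0 f : M f -> 0 <= p f.
Proof.
move=> Mf; apply: (le_p Mf) => _ [n [F [_ MF _ ->]]].
by apply: sumr_ge0 => i _; exact: (q_ge0 (MF i)).
Qed.

Let p_eq0 f : M f -> p f = 0 <-> ae_on I (fun x => f x = 0).
Proof.
move=> Mf; split => [pf|f0].
  apply: MEw_gauge_eq0 => //; apply/eqP; rewrite eq_le q_ge0// andbT.
  by have := MEw_gauge_le Mf; rewrite pf mulr0.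
apply/eqP; rewrite eq_le p_ge0// andbT (le_trans (MEw_norm_le Mf))//.
have mf : L0 I f by case: Mf.
(* A function vanishing a.e. is dominated by the empty family, so its gauge is at most C times 0.
   [MEw_norm] itself only admits n > 0, hence the detour through the gauge. *)
pose F (i : 'I_0) : R -> R := fun=> 0.
have MF : forall i, M (F i) := fun=> subspace0 MEw_subspace.
have fF : ae_on I (fun x => `|f x| <= \sum_(i < 0) `|F i x|).
  rewrite /ae_on in f0 *; apply: filterS f0 => x + Ix => /(_ Ix) ->.
  by rewrite big_ord0 normr0.
by have := (sum_le mf MF fF).2; rewrite big_ord0 mulr0.
Qed.

(** Dominating families scale with [c]. The reverse inequality comes later, from the factor c^-1
    applied to [c * f]. *)
Let pZ_le (c : R) f : c != 0 -> M f -> p (fun x => c * f x) <= `|c| * p f.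
Proof.
move=> c0 Mf; rewrite -ler_pdivrMl ?normr_gt0//.
apply: (le_p Mf) => _ [n [F [n0 MF fF ->]]].
rewrite ler_pdivrMl ?normr_gt0//; apply: p_le.
exists n, (fun i x => c * F i x); split; first exact: n0.
- by move=> i; exact: (subspaceZ MEw_subspace c (MF i)).
- rewrite /ae_on in fF *; apply: filterS fF => x + Ix => /(_ Ix) fFx.
  rewrite normrM; under eq_bigr do rewrite normrM.
  by rewrite -mulr_sumr ler_wpM2l.
by rewrite mulr_sumr; apply: eq_bigr => i _; rewrite -(MEw_gaugeZ EN (MF i) c0).
Qed.

Lemma MEw_lattice_norm : lattice_norm I M p.
Proof.
split; [exact: p_ge0|exact: p_eq0| | |].
- move=> c f Mf; have [->|c0] := eqVneq c 0.
    rewrite normr0 mul0r; apply: (p_eq0 (subspaceZ MEw_subspace 0 Mf)).2.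
    by apply: ae_onW => x _; rewrite mul0r.
  apply/eqP; rewrite eq_le (pZ_le c0 Mf)/=.
  rewrite -ler_pdivlMl ?normr_gt0// -normfV.
  have Mcf := subspaceZ MEw_subspace c Mf.
  have cV0 : c^-1 != 0 by rewrite invr_eq0.
  apply: le_trans (pZ_le cV0 Mcf).
  by under [X in _ <= p X]eq_fun do rewrite mulKf//.
- move=> f g Mf Mg; rewrite -lerBlDl; apply: (le_p Mg) => s Ss.
  rewrite lerBlDl -lerBlDr; apply: (le_p Mf) => r Sr; rewrite lerBlDr.
  apply: p_le; move: Sr Ss => [n [F [n0 MF fF ->]]] [m [H [_ MH gH ->]]].
  (* Concatenation of a family dominating [f] with one dominating [g]; the index is decoded by
     [fintype.split]. *)
  exists (n + m)%N, (fun i => match fintype.split i with inl j => F j | inr j => H j end).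
  have split_sum (u : (R -> R) -> R) :
      \sum_(i < n + m) u (match fintype.split i with inl j => F j | inr j => H j end) =
      \sum_(i < n) u (F i) + \sum_(i < m) u (H i).
    rewrite big_split_ord/=; congr (_ + _); apply: eq_bigr => i _.
      by rewrite -[lshift m i]/(unsplit (inl i)) unsplitK.
    by rewrite -[rshift n i]/(unsplit (inr i)) unsplitK.
  split; [by rewrite addn_gt0 n0| |  |by rewrite (split_sum q)].
    by move=> i; case: (fintype.split i).
  rewrite /ae_on in fF gH *; apply: filterS2 fF gH => x fFx gHx Ix.
  rewrite (split_sum (fun k => `|k x|)).
  by apply: le_trans (ler_normD _ _) _; apply: lerD; [exact: fFx|exact: gHx].
move=> f g Mf Mg fg; apply: (le_p Mg) => _ [n [F [n0 MF gF ->]]]; apply: p_le.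
exists n, F; split; [exact: n0|exact: MF| |by []]; rewrite /ae_on in fg gF *.
by apply: filterS2 fg gF => x fgx gFx Ix; apply: le_trans (fgx Ix) (gFx Ix).
Qed.

Lemma MEw_vector_lattice : vector_lattice I M.
Proof.
split; first exact: MEw_subspace.
  move=> f g Mf Mg; apply: (MD Mf Mg).
    by apply: measurable_maxr; [case: Mf|case: Mg].
  by apply: ae_onW => x _; case: (leP (f x) (g x)) => _; rewrite ?lerDl ?lerDr.
move=> f g Mf Mg; apply: (MD Mf Mg).
  by apply: measurable_minr; [case: Mf|case: Mg].
by apply: ae_onW => x _; case: (leP (f x) (g x)) => _; rewrite ?lerDl ?lerDr.
Qed.

End Proposition.

Theorem proposition4p5 (R : realType) (a : \bar R) (w : R -> R)
    (E : set (R -> R)) (N : (R -> R) -> R) (C : R)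
    (a_gt0 : (0 < a)%E)
    (w_gt0 : forall t, itv0 a t -> 0 < w t)
    (w_decr : forall s t, itv0 a s -> itv0 a t -> s <= t -> w t <= w s)
    (E_fsym : fully_symmetric (itv0 (wdm w (itv0 a))) E N)
    (C_ge1 : 1 <= C)
    (w_regular : forall t, itv0 a t ->
       (wdm w (itv0 t%:E) <= (C * t * w t)%:E)%E) :
  [/\ linear_subspace (itv0 a) (MEw a w E),
      lattice_norm (itv0 a) (MEw a w E) (MEw_norm a w E N),
      forall f, MEw a w E f ->
        MEw_norm a w E N f <= MEw_gauge a w N f /\
        MEw_gauge a w N f <= C * MEw_norm a w E N f &
      vector_lattice (itv0 a) (MEw a w E) /\
      normable (itv0 a) (MEw a w E) (MEw_gauge a w N)].
Proof.
have LN : lattice_norm (itv0 a) (MEw a w E) (MEw_norm a w E N).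
  exact: (@MEw_lattice_norm R a w E N C).
have bounds f : MEw a w E f -> MEw_norm a w E N f <= MEw_gauge a w N f /\
    MEw_gauge a w N f <= C * MEw_norm a w E N f.
  move=> Mf; split; first exact: (MEw_norm_le E_fsym Mf).
  exact: (@MEw_gauge_le R a w E N C).
split; [exact: (@MEw_subspace R a w E N C)|exact: LN|exact: bounds|].
split; first exact: (@MEw_vector_lattice R a w E N C).
exists (MEw_norm a w E N); first exact: LN.
exists 1, C; split; [exact: ltr01|exact: lt_le_trans C_ge1|].
by move=> f Mf; rewrite mul1r; exact: bounds.
Qed.
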